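(* Let $N_1,\dots,N_s\ge2$ ($s\ge1$) be pairwise coprime integers generating the multiplicative monoid $\mathcal S$. (a) For any $\sigma\in M^0(\mathbb T)$ we have $\Psi_{\mathcal S}(\sigma)\in P_{\kappa_s}(\mathbb T)$. (b) We have $$\Psi_{\mathcal S}\big(Z(\mathcal S,M^0(\mathbb T))\big)\subset\{\mu\in P_{\kappa_s}(\mathbb T): N_*\mu=\mu\text{ for all }N\in\mathcal S\}.$$ Moreover $$\Psi_{\mathcal S}\big(Z(\mathcal S,M^0_c(\mathbb T))\big)\subset\{\mu\in P_{\kappa_s}(\mathbb T):\mu\text{ is atomless and }N_*\mu=\mu\text{ for all }N\in\mathcal S\}.$$
   Context: $\mathbb T$ is the unit circle, $\varphi_N(\zeta)=\zeta^N$, $|C|\in[0,1]$ the normalized length of an arc ($|\mathbb T|=1$). An arc is a connected subset of $\mathbb T$. $\mathcal S=\{N_1^{\nu_1}\cdots N_s^{\nu_s}:\nu_i\ge0\}$. $M^0(\mathbb T)$ is the space of finite real Borel measures $\sigma$ on $\mathbb T$ with $\sigma(\mathbb T)=0$, and $M^0_c(\mathbb T)$ its subspace of atomless measures. A premeasure on $\mathbb T$ is a function $\mu$ from arcs to $\mathbb R$ such that $\mu(\emptyset)=\mu(\mathbb T)=0$; $\mu(C_1\cup C_2)=\mu(C_1)+\mu(C_2)$ for disjoint arcs $C_1,C_2$ whose union is an arc; and $\mu(C_\nu)\to0$ for every decreasing sequence of arcs $C_1\supset C_2\supset\cdots$ with empty intersection. It extends by finite additivity to finite disjoint unions of arcs.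 $M^0(\mathbb T)$ is contained in the space $P(\mathbb T)$ of premeasures. $\mu$ is atomless if $\mu(\{\zeta\})=0$ for all $\zeta\in\mathbb T$. For $x\in[0,1]$ let $\kappa_s(x)=x\sum_{\nu=0}^s\frac1{\nu!}|\log x|^\nu$ (with $\kappa_s(0)=0$). $P_{\kappa_s}(\mathbb T)$ is the set of premeasures of bounded $\kappa_s$-variation: there is a constant $A\ge0$ with $\sum_j|\mu(C_j)|\le A\sum_j\kappa_s(|C_j|)$ for all finite partitions $\{C_j\}$ of $\mathbb T$ into disjoint arcs. For $N\ge1$ and $\mu\in P(\mathbb T)$: $(N_*\mu)(C)=\mu(\varphi_N^{-1}(C))$, and $(N^*\mu)(C)=\frac1N\sum_{k=0}^{N-1}\mu(\varphi_N(C\cap I_k))$ with $I_k=\{e^{i\theta}:\tfrac{2\pi k}N\le\theta<\tfrac{2\pi(k+1)}N\}$. $Z(\mathcal S,M^0(\mathbb T))=\{\sigma\in M^0(\mathbb T): N_*\sigma=0\text{ for all }N\in\mathcal S, N\ne1\}$, and $Z(\mathcal S,M^0_c(\mathbb T))$ is its subspace of atomless measures. For $\sigma\in M^0(\mathbb T)$, $\Psi_{\mathcal S}(\sigma)$ is the premeasure $\Psi_{\mathcal S}(\sigma)(C)=\sum_{N\in\mathcal S}(N^*\sigma)(C)$ (the series converges absolutely on every arc $C$ and defines a premeasure). *)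

(* Defs.v *)
From HB Require Import structures.
From mathcomp Require Import all_boot all_order all_algebra.
From mathcomp Require Import all_classical all_reals all_analysis.
From mathcomp Require Import complex.

Set Implicit Arguments.
Unset Strict Implicit.
Unset Printing Implicit Defensive.

Import Order.TTheory GRing.Theory Num.Theory numFieldNormedType.Exports.

Local Open Scope classical_set_scope.
Local Open Scope ring_scope.
Local Open Scope complex_scope.

Definition circle (R : realType) : Type := {z : R[i] | `|z| == 1}.

Section circle.
Variable R : realType.

HB.instance Definition _ := Choice.on (circle R).
(* R[i]^o carries the topology of the complex norm; the circle gets the
   induced one. *)
HB.instance Definition _ := Topological.copy (circle R)
  (initial_topology (val : circle R -> R[i]^o)).

Lemma expi_subproof (t : R) : `|cos t +i* sin t| == 1.
Proof. by rewrite normc_def /= cos2Dsin2 sqrtr1. Qed.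

Definition expi (t : R) : circle R := Sub (cos t +i* sin t) (expi_subproof t).

HB.instance Definition _ := isPointed.Build (circle R) (expi 0).

Lemma phi_subproof (N : nat) (z : circle R) : `|val z ^+ N| == 1.
Proof. by rewrite normrX (eqP (valP z)) expr1n. Qed.

Definition phi (N : nat) (z : circle R) : circle R :=
  Sub (val z ^+ N) (phi_subproof N z).

Definition arc (C : set (circle R)) : Prop := connected C.

(* Normalized length: the measure of the angles, in units of a full turn. *)
Definition arc_length (C : set (circle R)) : R :=
  fine (lebesgue_measure
    [set t : R | `[0, 1[%classic t /\ C (expi (2 * pi * t))]).

Definition arc_decomposition (A : set (circle R)) (n : nat)
    (C : 'I_n -> set (circle R)) : Prop :=
  [/\ forall j, arc (C j), trivIset setT C & \bigcup_j C j = A].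

(* A premeasure is represented by a function on all subsets of the circle, of
   which only the values on arcs are meaningful. *)
Definition premeasure (mu : set (circle R) -> R) : Prop :=
  [/\ mu set0 = 0, mu setT = 0,
      forall C1 C2, arc C1 -> arc C2 -> arc (C1 `|` C2) ->
        C1 `&` C2 = set0 -> mu (C1 `|` C2) = mu C1 + mu C2
    & forall C : nat -> set (circle R), (forall n, arc (C n)) ->
        (forall n, C n.+1 `<=` C n) -> \bigcap_n C n = set0 ->
        mu (C n) @[n --> \oo] --> (0 : R)].

(* Extension to finite disjoint unions of arcs by finite additivity. For a
   premeasure the sum does not depend on the decomposition; on a set that is
   not a finite union of arcs the value is an irrelevant 0. *)
Definition ext (mu : set (circle R) -> R) (A : set (circle R)) : R :=
  xget 0 [set v | exists n (C : 'I_n -> set (circle R)),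
    arc_decomposition A C /\ v = \sum_(j < n) mu (C j)].

Definition atomless (mu : set (circle R) -> R) : Prop :=
  forall z, mu [set z] = 0.

Definition kappa (s : nat) (x : R) : R :=
  x * \sum_(0 <= nu < s.+1) `|ln x| ^+ nu / (nu`!)%:R.

Definition P_kappa (s : nat) : set (set (circle R) -> R) :=
  [set mu | premeasure mu /\
    exists2 A : R, 0 <= A &
      forall n (C : 'I_n -> set (circle R)), arc_decomposition setT C ->
        \sum_(j < n) `|mu (C j)| <=
          A * \sum_(j < n) kappa s (arc_length (C j))].

(* The operator usually written N_*, resp. N^* for [pull] below; N >= 1. *)
Definition push (N : nat) (mu : set (circle R) -> R) (C : set (circle R)) : R :=
  ext mu (phi N @^-1` C).

Definition sector (N k : nat) : set (circle R) :=
  expi @` `[2 * pi * k%:R / N%:R, 2 * pi * k.+1%:R / N%:R[%classic.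

Definition pull (N : nat) (mu : set (circle R) -> R) (C : set (circle R)) : R :=
  N%:R^-1 * \sum_(0 <= k < N) ext mu (phi N @` (C `&` sector N k)).

(* Finite real Borel measures: charges are finite-valued. *)
Definition borel_charge : Type :=
  {charge set (g_sigma_algebraType (@open (circle R))) -> \bar R}.

Definition premeas (sigma : borel_charge) (C : set (circle R)) : R :=
  fine (sigma C).

Definition M0 : set borel_charge := [set sigma | sigma setT = 0%E].

Definition M0c : set borel_charge :=
  [set sigma | M0 sigma /\ atomless (premeas sigma)].

Definition Z (S : set nat) (E : set borel_charge) : set borel_charge :=
  [set sigma | E sigma /\ forall N, S N -> N <> 1%N ->
     forall C, arc C -> push N (premeas sigma) C = 0].

(* The sum over S is taken in increasing order of N; on arcs it converges
   absolutely, so that the order does not matter. *)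
Definition Psi (S : set nat) (sigma : borel_charge) (C : set (circle R)) : R :=
  limn (fun n => \sum_(0 <= N < n | N \in S) pull N (premeas sigma) C).

Definition invariant_premeasure (S : set nat) (mu : set (circle R) -> R) : Prop :=
  forall N, S N -> forall C, arc C -> push N mu C = mu C.

End circle.

Definition generated_monoid (s : nat) (N : 'I_s -> nat) : set nat :=
  [set (\prod_(i < s) N i ^ nu i)%N | nu in [set: 'I_s -> nat]].

(* Main.v *)
(* In the angle coordinate t of exp(2 i pi t), (N^* sigma)(C) is 1/N times the
   sum over the N sectors [k/N, (k+1)/N[ of the mass of the N-fold dilation of
   the part of C in that sector.  As sigma has total mass 0, only the sectors
   cut by C contribute: at most four for an arc, so |N^* sigma (C)| is O(1/N).
   For a partition into arcs C_j and a fixed N, a sector that meets an arc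
   shorter than 1/N is either filled by such arcs or cut by a longer arc; hence
   sum_j |N^* sigma (C_j)| <= const * sum_j min(|C_j|, 1/N).  Summing over the
   monoid, sum_(N in S) min(x, 1/N) <= const * kappa_s(x), which gives (a).
   For (b), write M = M'd and N = N'd with M', N' coprime; then
   M_* N^* = N'^* M'_*, and M' is again in S.  So M_* N^* sigma is (N/M)^* sigma
   if M divides N, and 0 otherwise; summing over N in S gives M_* Psi = Psi. *)
Require Import Defs.
From HB Require Import structures.
From mathcomp Require Import all_boot all_order all_algebra.
From mathcomp Require Import all_classical all_reals all_analysis.
From mathcomp Require Import measurable_realfun complex zify ring lra.

Set Implicit Arguments.
Unset Strict Implicit.
Unset Printing Implicit Defensive.

Import Order.TTheory GRing.Theory Num.Theory numFieldNormedType.Exports.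

Local Open Scope classical_set_scope.
Local Open Scope ring_scope.

(** * The circle in angle coordinates *)

Section turn.
Variable R : realType.
Implicit Types (t a b : R) (z : circle R).

(** [ext] picks an arbitrary decomposition and defaults to 0, so it cannot be computed with
    directly. Everything is therefore moved to angles in [0, 1[, where [sigma] becomes a finitely
    additive [mass] on measurable sets; each [ext] is then a value of such a set function, or a
    limit of sums of such values. The price is the cut at angle 0: an arc may become two intervals,
    and each of them can cut two sectors, whence the bound four. The estimate in (a) cannot be made
    arc by arc: around a point mass, an arc much shorter than 1/N can still carry N^* sigma of order
    1/N, so no bound by min(|C|, 1/N) holds for a single arc. It holds for partitions because the
    short arcs inside one sector have disjoint rescaled images, which share the total variation of
    [sigma] once instead of each claiming all of it. Since [sigma] is signed, that variation, taken
    from a Hahn decomposition, carries all the estimates; it also gives the continuity along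
    decreasing arcs. *)

Definition turn t : circle R := expi (2 * pi * t).

Lemma val_turn t :
  val (turn t) = (cos (2 * pi * t) +i* sin (2 * pi * t))%C.
Proof. by []. Qed.

Lemma turnD1 t : turn (t + 1) = turn t.
Proof.
apply: val_inj; rewrite !val_turn mulrDr mulr1 mulr_natl.
by rewrite cosD2pi sinD2pi.
Qed.

Lemma turnDn t n : turn (t + n%:R) = turn t.
Proof. by elim: n => [|n IH]; rewrite ?addr0// -natr1 addrA turnD1. Qed.

Lemma phi_turn N t : phi N (turn t) = turn (N%:R * t).
Proof.
apply: val_inj; rewrite /= -/(turn t).
elim: N => [|N IH].
  by rewrite expr0 mul0r mulr0 cos0 sin0.
have -> : 2 * pi * (N.+1%:R * t) = 2 * pi * t + 2 * pi * (N%:R * t).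
  by rewrite -natr1; ring.
rewrite exprS IH cosD sinD.
by apply/eqP; rewrite eq_complex /= !eqxx/= addrC.
Qed.

Lemma turn_surj z : exists2 t, 0 <= t < 1 & turn t = z.
Proof.
case: z => -[x y] h; have := h => /eqP; rewrite normc_def => /(congr1 (fun w => complex.Re w)) /= e.
have xy : x ^+ 2 + y ^+ 2 = 1.
  by rewrite -[LHS]sqr_sqrtr ?e ?expr1n// addr_ge0 ?sqr_ge0.
have x1 : -1 <= x <= 1 by nra.
have [/andP[a0 api] ca] := acos_def x1.
have pi0 := pi_gt0 R.
have sa : sin (acos x) = `|y|.
  by rewrite sin_acos// -xy addrAC subrr add0r sqrtr_sqr.
have [y0|y0] := leP 0 y.
  exists (acos x / (2 * pi)).
    rewrite divr_ge0//=; last by rewrite mulr_ge0// ltW.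
    by rewrite ltr_pdivrMr; nra.
  apply: val_inj; rewrite val_turn mulrC divfK ?gt_eqF ?mulr_gt0//.
  by rewrite ca sa ger0_norm.
have a0' : 0 < acos x.
  rewrite lt_neqAle a0 andbT; apply/eqP => a00; move: sa.
  by rewrite -a00 sin0 ltr0_norm//; lra.
(* Here y < 0: [acos x] is the angle of the conjugate point, so it is subtracted from a full turn;
   [a0'] keeps the witness below 1. *)
exists (1 - acos x / (2 * pi)).
  rewrite ltrBlDr ltrDl divr_gt0 ?mulr_gt0// andbT subr_ge0.
  by rewrite ler_pdivrMr; nra.
apply: val_inj; rewrite val_turn mulrBr mulr1.
have -> : 2 * pi * (acos x / (2 * pi)) = acos x.
  by rewrite mulrC divfK ?gt_eqF ?mulr_gt0.
rewrite addrC mulr_natl cosD2pi sinD2pi cosN sinN ca sa ltr0_norm//.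
by rewrite opprK.
Qed.

(** Equal points give cos(2 pi (t2 - t1)) = 1, hence sin(pi (t2 - t1)) = 0 by the double angle
    formula; but the sine is positive strictly between 0 and pi. *)
Lemma turn_inj_lt t1 t2 : t1 < t2 < t1 + 1 -> turn t1 <> turn t2.
Proof.
move=> /andP[lt1 lt2] e.
have pi0 := pi_gt0 R.
have [ec es] : cos (2 * pi * t1) = cos (2 * pi * t2) /\
               sin (2 * pi * t1) = sin (2 * pi * t2).
  by move/(congr1 val): e; rewrite !val_turn => -[].
have : cos (2 * pi * t2 - 2 * pi * t1) = 1.
  by rewrite cosB ec es -!expr2 cos2Dsin2.
rewrite -mulrBr -mulrA mulr_natl cos_mulr2n cos2sin2 => h.
have /eqP : sin (pi * (t2 - t1)) ^+ 2 = 0 by lra.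
rewrite sqrf_eq0 => /eqP s0.
suff : 0 < sin (pi * (t2 - t1)) by rewrite s0 ltxx.
by apply: sin_gt0_pi; rewrite mulr_gt0 ?subr_gt0//= gtr_pMr//; lra.
Qed.

Lemma turn_inj a t1 t2 : a <= t1 < a + 1 -> a <= t2 < a + 1 ->
  turn t1 = turn t2 -> t1 = t2.
Proof.
move=> h1 h2 e; apply/eqP; rewrite eq_le !leNgt; apply/andP; split;
  apply/negP => lt; [apply: (@turn_inj_lt t2 t1)|apply: (@turn_inj_lt t1 t2)] => //;
  lra.
Qed.

Lemma turn_onto a z : exists2 t, a <= t < a + 1 & turn t = z.
Proof.
have [u /andP[u0 u1] <-] := turn_surj z.
have [m [b b01 ->]] : exists m : int, exists2 b, 0 <= b < 1 & a = m%:~R + b.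
  exists (Num.floor a); exists (a - (Num.floor a)%:~R); last by ring.
  by have := floor_itv a; rewrite intrD => /andP[h1 h2]; apply/andP; split; lra.
have turnDm x (k : int) : turn (x + k%:~R) = turn x.
  case: k => k; first by rewrite -pmulrn turnDn.
  by rewrite -[in RHS](subrK k.+1%:R x) turnDn NegzE mulrNz -pmulrn.
have /andP[b0 b1] := b01.
have [bu|ub] := leP b u.
  exists (u + m%:~R); last exact: turnDm.
  by apply/andP; split; lra.
exists (u + (m + 1)%:~R); last exact: turnDm.
by rewrite intrD; apply/andP; split; lra.
Qed.

Lemma continuous_turn : continuous turn.
Proof.
have cg (f : R -> R) : continuous f -> continuous (fun t => f (2 * pi * t)).
  move=> cf t; apply: continuous_comp (cf _).
  exact: mulrl_continuous.
have cval : continuous (val \o turn : R -> R[i]^o).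
  move=> t; apply/cvgrPdist_lt => e e0.
  have er : e \is Num.real by rewrite gtr0_real.
  pose r := complex.Re e.
  have eE : e = (r%:C)%C by rewrite /r RRe_real.
  have r0 : 0 < r by rewrite -ltcR -eE.
  have /cvgrPdist_lt/(_ (r / 2)) hc := cg _ (@continuous_cos R) t.
  have /cvgrPdist_lt/(_ (r / 2)) hs := cg _ (@continuous_sin R) t.
  have r2 : 0 < r / 2 by rewrite divr_gt0.
  move: (hc r2) (hs r2); apply: filterS2 => u hcu hsu /=.
  rewrite eE [`|_|]normc_def /= ltcR -[ltRHS]gtr0_norm// -sqrtr_sqr.
  rewrite ltr_sqrt ?exprn_gt0//.
  move: hcu hsu; set p := cos _ - cos _; set q := sin _ - sin _.
  by rewrite !ltr_norml => /andP[? ?] /andP[? ?]; nra.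
apply/continuousP => A [B oB <-].
have -> : turn @^-1` (val @^-1` B) = (val \o turn : R -> R[i]^o) @^-1` B by [].
by move/continuousP : cval; exact.
Qed.
End turn.
Arguments turn {R} t.

(** * Arcs as intervals of angles *)

Section arcs.
Variable R : realType.
Implicit Types (t a b : R) (z : circle R).

Lemma closed_turn_segment a b : closed (turn @` `[a, b]).
Proof.
pose K := (val \o turn : R -> R[i]^o) @` `[a, b]%classic.
have cK : closed K.
  apply: compact_closed; first exact: norm_hausdorff.
  apply: continuous_compact; last exact: segment_compact.
  apply: continuous_subspaceT => t.
  apply: continuous_comp; first exact: continuous_turn.
  exact: initial_continuous.
have -> : turn @` `[a, b] = (val : circle R -> R[i]^o) @^-1` K.
  apply/seteqP; split=> [_ [t tab <-]|z [t tab /= e]]; first by exists t.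
  by exists t => //; apply: val_inj.
by apply: closed_comp cK => z _; exact: initial_continuous.
Qed.

Lemma turn_openC a b : a <= b <= a + 1 ->
  turn @` `]a, b[ = ~` (turn @` `[b, a + 1]).
Proof.
move=> /andP[ab b1]; apply/seteqP; split=> [_ [t /= + <-] [u /= + ]|z].
  rewrite !in_itv/= => /andP[at_ tb] /andP[bu ua] e.
  by apply: (@turn_inj_lt R t u) => //; apply/andP; split; lra.
have [t /andP[t1 t2] <-] := turn_onto a z.
have [tb|bt] := ltP t b; last first.
  by case; exists t => //=; rewrite in_itv/= bt ltW.
have [->|ta] := eqVneq t a.
  by case; exists (a + 1); [rewrite /= in_itv/= b1/= | rewrite turnD1].
by move=> _; exists t => //=; rewrite in_itv/= lt_neqAle eq_sym ta t1.
Qed.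

Lemma open_turn_itv a b : a <= b <= a + 1 -> open (turn @` `]a, b[).
Proof. by move=> ab; rewrite turn_openC// openC; exact: closed_turn_segment. Qed.

Lemma arc_turn (J : set R) : is_interval J -> Defs.arc (turn @` J).
Proof.
move=> iJ; apply: connected_continuous_connected.
  exact/connected_intervalP.
exact/continuous_subspaceT/continuous_turn.
Qed.

(** Cut open at a point outside [C], the circle has no wrap-around left. If an angle t2 between two
    angles of [C] were missing, the images of ]a, t2[ and [a, t2] would have the same trace on [C],
    as neither endpoint lies in [C]; this trace would be open and closed in [C], nonempty and
    proper. *)
Lemma arc_is_interval (C : set (circle R)) a : Defs.arc C -> ~ C (turn a) ->
  is_interval [set t | a < t < a + 1 /\ C (turn t)].
Proof.
move=> aC Ca t1 t3 [/andP[at1 t1a] C1] [/andP[at3 t3a] C3] t2 /andP[t12 t23].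
have at2 : a < t2 by lra.
have t2a : t2 < a + 1 by lra.
split; first by rewrite at2.
apply: contrapT => C2.
have ne12 : t1 != t2 by apply: contra_notN C2 => /eqP <-.
have ne23 : t2 != t3 by apply: contra_notN C2 => /eqP ->.
have /seteqP[_] : C `&` (turn @` `]a, t2[) = C.
  apply: aC.
  - exists (turn t1); split => //; exists t1 => //=.
    by rewrite in_itv/= at1 lt_neqAle ne12.
  - by exists (turn @` `]a, t2[) => //; apply: open_turn_itv; lra.
  - exists (turn @` `[a, t2]); first exact: closed_turn_segment.
    apply/seteqP; split=> z [Cz [t /=]]; rewrite in_itv/= => /andP[ta tt2] tz.
      by split=> //; exists t => //=; rewrite in_itv/= !ltW.
    split=> //; exists t => //=; rewrite in_itv/= !lt_neqAle ta tt2 !andbT.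
    by apply/andP; split; apply/eqP => e; move: Cz; rewrite -tz; [rewrite -e|rewrite e].
move=> /(_ (turn t3) C3) [_ [t /=]]; rewrite in_itv/= => /andP[ta tt2] e.
by apply: (@turn_inj_lt R t t3) => //; rewrite (lt_le_trans tt2)//=; lra.
Qed.

Definition angle_set (A : set (circle R)) : set R := [set t | 0 <= t < 1 /\ A (turn t)].

(** Two intervals, because the window [0, 1[ cuts the circle at angle 0, which may lie inside [C].
    Unrolled from a missed point [turn a], [C] is one interval in ]a, a + 1[, whose part from 1 on
    is moved back by one turn. *)
Lemma arc_angle_set (C : set (circle R)) : Defs.arc C -> exists J1 J2 : set R,
  [/\ is_interval J1, is_interval J2, J1 `&` J2 = set0 &
   angle_set C = J1 `|` J2].
Proof.
move=> aC; have [[z Cz]|CT] := pselect (exists z, ~ C z); last first.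
  exists `[0, 1[%classic, set0; split.
  - exact: interval_is_interval.
  - by [].
  - by rewrite setI0.
  - rewrite setU0; apply/seteqP; split=> t /=; rewrite in_itv/=; first by case.
    by move=> t01; split=> //; apply: contrapT => h; apply: CT; exists (turn t).
have [a /andP[a0 a1] az] := turn_surj z; rewrite -az in Cz.
have iJ := arc_is_interval aC Cz.
exists ([set t | a < t < a + 1 /\ C (turn t)] `&` [set t | t < 1]).
exists [set t | (a < t + 1 < a + 1 /\ C (turn (t + 1))) /\ 0 <= t]; split.
- move=> x y [Jx x1] [Jy y1] t /andP[xt ty]; split; last by rewrite /=; move: y1; rewrite /=; lra.
  by apply: iJ Jx Jy _ _; rewrite xt.
- move=> x y [Jx x1] [Jy y1] t /andP[xt ty]; split; last by rewrite /=; lra.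
  by apply: iJ Jx Jy _ _; rewrite !lerD2r xt.
- by rewrite -subset0 => t [[[/andP[h1 h2] _] /= h3] [[/andP[h4 h5] _] h6]]; lra.
- apply/seteqP; split=> [t [/andP[t0 t1] Ct]|t].
    have [at_|ta] := ltP a t; first by left; rewrite /= t1; do ?split => //; lra.
    right; rewrite /= turnD1; do ?split => //.
    have ta' : t != a by apply: contraPneq Ct => ->.
    by have {ta ta'} : t < a; rewrite ?lt_neqAle ?ta'//; lra.
  case=> [[[/andP[h1 h2] h3] /= h4]|[[/andP[h1 h2] +] h3]]; last rewrite turnD1.
    by split=> //; lra.
  by split=> //; lra.
Qed.

Definition angle z : R := xget 0 [set t | 0 <= t < 1 /\ turn t = z].

Lemma angleP z : 0 <= angle z < 1 /\ turn (angle z) = z.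
Proof. by have [t t1 tz] := turn_surj z; rewrite /angle; case: xgetP => // /(_ t)[]. Qed.

Lemma turnK t : 0 <= t < 1 -> angle (turn t) = t.
Proof.
by move=> t01; have [a01 /(@turn_inj _ 0)] := angleP (turn t); rewrite add0r; exact.
Qed.

Lemma turn_image (B : set R) : B `<=` [set t | 0 <= t < 1] ->
  turn @` B = angle @^-1` B.
Proof.
move=> B01; apply/seteqP; split=> [_ [t Bt <-]|z Bz].
  by rewrite /preimage/= turnK//; exact: B01.
by exists (angle z) => //; case: (angleP z).
Qed.

(** [angle] jumps at angle 0, but the preimages of the rays ]x, +oo[, which generate the Borel sets,
    are open arcs for 0 <= x < 1 and trivial for other x. *)
Lemma measurable_angle :
  measurable_fun setT (angle : g_sigma_algebraType (@open (circle R)) -> R).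
Proof.
apply: (measurability _ (RGenOInfty.measurableE R)) => //.
move=> /= _ [_ [x ->] <-]; rewrite setTI.
have [x0|x0] := ltP x 0.
  rewrite (_ : _ @^-1` _ = setT)//; apply/seteqP; split=> z //= _.
  by rewrite in_itv/= andbT; have [/andP[? _] _] := angleP z; lra.
have [x1|x1] := ltP x 1; last first.
  rewrite (_ : _ @^-1` _ = set0)//; apply/seteqP; split=> z //=.
  by rewrite in_itv/= andbT; have [/andP[_ ?] _] := angleP z; lra.
rewrite (_ : _ @^-1` _ = turn @` `]x, 1[).
  apply: sub_sigma_algebra; apply: open_turn_itv; lra.
rewrite turn_image; last by move=> t /=; rewrite in_itv/= => /andP[? ?]; lra.
apply/seteqP; split=> z /=; rewrite !in_itv/= ?andbT.
  by have [/andP[_ ->] _] := angleP z; rewrite andbT.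
by case/andP.
Qed.

End arcs.

(** * Additive set functions of angles and the extension to unions of arcs *)

Section finite_additivity.
Variable R : realType.
Implicit Types (g : set R -> R) (A B : set R).

(** Shared by the mass of the charge, its total variation and the length. *)
Definition finitely_additive g := g set0 = 0 /\
  forall A B, measurable A -> measurable B -> A `&` B = set0 ->
    g (A `|` B) = g A + g B.

Lemma finitely_additive_bigcup g (I : finType) (F : I -> set R) (P : pred I) :
  finitely_additive g -> (forall i, measurable (F i)) -> trivIset setT F ->
  g (\bigcup_(i in [set` P]) F i) = \sum_(i | P i) g (F i).
Proof.
move=> [g0 gU] mF tF.
have -> : [set` P] = [set` enum P].
  by apply/seteqP; split=> i /=; rewrite mem_enum.
have -> : \sum_(i | P i) g (F i) = \sum_(i <- enum P) g (F i) by rewrite big_enum.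
rewrite bigcup_seq.
elim: (enum P) (enum_uniq P) => [|i s IH] /=; first by rewrite !big_nil.
case/andP=> is_ us; rewrite !big_cons gU ?IH//.
  by rewrite -bigcup_seq; apply: fin_bigcup_measurable => //; exact: finite_seq.
rewrite -bigcup_seq -subset0 => t [Fit [j /= js Fjt]].
have ij : i = j by apply: tF => //; exists t.
by move: is_; rewrite ij js.
Qed.

End finite_additivity.

Section angle_set.
Variable R : realType.
Implicit Types (A B C : set (circle R)) (mu : set (circle R) -> R).

Lemma preimage_angle_set A : @angle R @^-1` (angle_set A) = A.
Proof.
by apply/seteqP; split=> z /=; rewrite /angle_set/=; have [-> ->] := angleP z; [case|].
Qed.

Lemma angle_set_turn (B : set R) : B `<=` [set t | 0 <= t < 1] -> angle_set (turn @` B) = B.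
Proof.
move=> B01; apply/seteqP; split=> [t [t01 [u Bu]]|t Bt].
  by move/(@turn_inj _ 0); rewrite add0r => <- //; exact: B01.
by split; [exact: B01|exists t].
Qed.

Lemma angle_set_bigcup (I : Type) (P : set I) (F : I -> set (circle R)) :
  angle_set (\bigcup_(i in P) F i) = \bigcup_(i in P) angle_set (F i).
Proof.
apply/seteqP; split=> [t [t01 [i Pi Ft]]|t [i Pi [t01 Ft]]]; first by exists i.
by split=> //; exists i.
Qed.

Lemma trivIset_angle_set (I : Type) (F : I -> set (circle R)) :
  trivIset setT F -> trivIset setT (fun i => angle_set (F i)).
Proof.
by move=> tF i j _ _ [t [[_ Fi] [_ Fj]]]; apply: tF => //; exists (turn t).
Qed.

Lemma measurable_angle_set C : Defs.arc C -> measurable (angle_set C).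
Proof.
move=> /arc_angle_set[J1 [J2 [i1 i2 _ ->]]].
by apply: measurableU; exact: is_interval_measurable.
Qed.

Definition decomposable A := exists n (C : 'I_n -> set (circle R)),
  arc_decomposition A C.

Lemma decomposable_fin (I : finType) (J : I -> set R) A :
  (forall i, is_interval (J i)) -> trivIset setT J -> angle_set A = \bigcup_i J i ->
  decomposable A.
Proof.
move=> iJ tJ AJ.
have J01 i : J i `<=` [set t | 0 <= t < 1].
  move=> t Jt; have : angle_set A t by rewrite AJ; exists i.
  by case.
exists #|I|, (fun j => turn @` J (enum_val j)); split.
- by move=> j; exact: arc_turn.
- move=> i j _ _ [_ [[t Jt <-] [u Ju]]] /(@turn_inj _ 0).
  rewrite add0r => /(_ (J01 _ _ Ju) (J01 _ _ Jt)) ut; apply: enum_val_inj.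
  by apply: tJ => //; exists t; split=> //; rewrite -ut.
- rewrite -[RHS]preimage_angle_set AJ; under eq_bigcupr do rewrite turn_image//.
  rewrite -preimage_bigcup; congr (_ @^-1` _); apply/seteqP.
  split=> [t [j _ Jt]|t [i _ Jt]]; first by exists (enum_val j).
  by exists (enum_rank i) => //; rewrite enum_rankK.
Qed.

Lemma decomposable_intervals2 (J1 J2 : set R) A : is_interval J1 -> is_interval J2 ->
  J1 `&` J2 = set0 -> angle_set A = J1 `|` J2 -> decomposable A.
Proof.
move=> i1 i2 J12 AJ.
apply: (@decomposable_fin bool (fun b => if b then J1 else J2)).
- by case.
- move: J12; rewrite -subset0 => J12.
  by move=> [|] [|]// _ _ [t [h1 h2]]; case: (J12 t).
- rewrite AJ; apply/seteqP; split=> [t [|]|t [[] _]]; do ?[by left|by right].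
    by exists true.
  by exists false.
Qed.

Lemma ext_eq mu A v : decomposable A ->
  (forall n (C : 'I_n -> set (circle R)), arc_decomposition A C ->
     \sum_(j < n) mu (C j) = v) ->
  ext mu A = v.
Proof.
move=> [n [C AC]] h; rewrite /ext; case: xgetP => [w -> [m [D [AD ->]]]|].
  exact: h.
by move/(_ v); case; exists n, C; split; rewrite ?h.
Qed.

(** All decompositions of [A] give the same sum, so the choice made by [ext] is harmless;
    [decomposable A] rules out its default value 0. *)
Lemma ext_additive mu (g : set R -> R) A : finitely_additive g ->
  (forall C, Defs.arc C -> mu C = g (angle_set C)) -> decomposable A ->
  ext mu A = g (angle_set A).
Proof.
move=> ag mug dA; apply: ext_eq => // n C [aC tC <-].
under eq_bigr do rewrite mug//.
rewrite angle_set_bigcup -(@finitely_additive_bigcup _ g 'I_n (fun j => angle_set (C j)) predT)//.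
- by congr (g (bigcup _ _)); apply/seteqP; split.
- by move=> i; exact: measurable_angle_set.
- exact: trivIset_angle_set.
Qed.

(** In angles, the image under [phi N] of the part of [C] in sector k: u -> (u + k) / N is the
    inverse branch carrying [0, 1[ onto that sector. *)
Definition fiber N k C : set R :=
  [set u | 0 <= u < 1 /\ C (turn ((u + k%:R) / N%:R))].

Lemma fiberE N k C : (k < N)%N ->
  fiber N k C = [set u | 0 <= u < 1 /\ angle_set C ((u + k%:R) / N%:R)].
Proof.
move=> kN; have N0 : 0 < N%:R :> R by rewrite ltr0n (leq_ltn_trans _ kN).
apply/seteqP; split=> u [/andP[u0 u1]]; last by case; rewrite /fiber/= u0.
move=> Cu; split; first by rewrite u0.
split=> //; rewrite divr_ge0 ?addr_ge0//= ltr_pdivrMr// mul1r.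
have : k.+1%:R <= N%:R :> R by rewrite ler_nat.
by rewrite -natr1; lra.
Qed.

Lemma is_interval_affine (J : set R) (b c : R) : 0 <= c -> is_interval J ->
  is_interval [set u | 0 <= u < 1 /\ J ((u + b) * c)].
Proof.
move=> c0 iJ x y [/andP[x0 x1] Jx] [/andP[y0 y1] Jy] z /andP[xz zy].
split; first by apply/andP; split; lra.
by apply: iJ Jx Jy _ _; rewrite !ler_wpM2r ?lerD2r.
Qed.

Lemma fiber_intervals N k C : (k < N)%N -> Defs.arc C -> exists J1 J2 : set R,
  [/\ is_interval J1, is_interval J2, J1 `&` J2 = set0 & fiber N k C = J1 `|` J2].
Proof.
move=> kN /arc_angle_set[J1 [J2 [i1 i2 J12 CJ]]]; rewrite fiberE//.
exists [set u | 0 <= u < 1 /\ J1 ((u + k%:R) / N%:R)].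
exists [set u | 0 <= u < 1 /\ J2 ((u + k%:R) / N%:R)].
split; try exact: is_interval_affine.
  move: J12; rewrite -!subset0 => J12 u [[_ h1] [_ h2]].
  by case: (J12 ((u + k%:R) / N%:R)).
rewrite CJ; apply/seteqP; split=> [u [u01 [|]]|u [[u01 h]|[u01 h]]].
- by left.
- by right.
- by split=> //; left.
- by split=> //; right.
Qed.

Lemma measurable_fiber N k C : (k < N)%N -> Defs.arc C -> measurable (fiber N k C).
Proof.
move=> kN /(fiber_intervals kN)[J1 [J2 [i1 i2 _ ->]]].
by apply: measurableU; exact: is_interval_measurable.
Qed.

Lemma fiber01 N k C : fiber N k C `<=` [set t | 0 <= t < 1].
Proof. by move=> u []. Qed.

Lemma decomposable_turn_fiber N k C : (k < N)%N -> Defs.arc C ->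
  decomposable (turn @` fiber N k C).
Proof.
move=> kN /(fiber_intervals kN)[J1 [J2 [i1 i2 J12 f12]]].
by apply: (@decomposable_intervals2 J1 J2); rewrite ?angle_set_turn//; exact: fiber01.
Qed.

Lemma phi_sector N k C : (k < N)%N ->
  phi N @` (C `&` sector N k) = turn @` fiber N k C.
Proof.
move=> kN; have N0 : 0 < N%:R :> R by rewrite ltr0n (leq_ltn_trans _ kN).
have pi0 := pi_gt0 R.
have pi2 : 0 < 2 * pi :> R by rewrite mulr_gt0.
apply/seteqP; split=> [_ [z [Cz [t + tz]] <-]|_ [u [/andP[u0 u1] Cu] <-]].
  rewrite /= in_itv/= => /andP[t1 t2].
  have zE : turn (t / (2 * pi)) = expi t.
    by rewrite /turn [X in expi X]mulrC divfK ?gt_eqF.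
  exists (N%:R * (t / (2 * pi)) - k%:R); last first.
    by rewrite -(turnDn _ k) subrK -phi_turn zE tz.
  split; last by rewrite subrK [X in turn X]mulrC mulKf ?gt_eqF// zE tz.
  rewrite mulrA; move: t1 t2.
  rewrite ler_pdivrMr// ltr_pdivlMr// -natr1 => t1 t2.
  rewrite subr_ge0 ler_pdivlMr// ltrBlDr ltr_pdivrMr//.
  by apply/andP; split; nra.
exists (turn ((u + k%:R) / N%:R)); last first.
  by rewrite phi_turn mulrC divfK ?gt_eqF// turnDn.
split=> //; exists (2 * pi * ((u + k%:R) / N%:R)) => //=.
rewrite in_itv/= -natr1 -!mulrA !ler_pM2l ?ltr_pM2l//.
by rewrite ler_pM2r ?ltr_pM2r ?invr_gt0//; apply/andP; split; lra.
Qed.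

(** The operator N^* in angle coordinates. It goes through no decomposition into arcs, and so can be
    computed on preimages of arcs under [phi M] as well. *)
Definition transfer (g : set R -> R) N C :=
  N%:R^-1 * \sum_(0 <= k < N) g (fiber N k C).

Lemma pull_transfer mu (g : set R -> R) N C : finitely_additive g ->
  (forall C, Defs.arc C -> mu C = g (angle_set C)) -> Defs.arc C ->
  pull N mu C = transfer g N C.
Proof.
move=> ag mug aC; rewrite /pull /transfer; congr (_ * _).
rewrite !big_mkord; apply: eq_bigr => k _.
rewrite phi_sector// (ext_additive ag)//; last exact: decomposable_turn_fiber.
by rewrite angle_set_turn//; exact: fiber01.
Qed.

End angle_set.

(** * Sums over the monoid *)

Section monoid_sums.
Variable R : realType.

Lemma sum_geometric_le (r : R) n : 0 <= r < 1 ->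
  \sum_(i < n) r ^+ i <= (1 - r)^-1.
Proof.
case/andP=> r0 r1; have r1' : 0 < 1 - r by rewrite subr_gt0.
rewrite -[leRHS]mul1r ler_pdivlMr// mulrC -opprB mulNr -subrX1 opprB.
by rewrite lerBlDr lerDl exprn_ge0.
Qed.

(** The sum of the geometric series of ratio 2^(-d) is O(1/d). With y = d ln 2 <= 1 it follows from
    exp(-y) <= 1/(1 + y) <= 1 - y/2. *)
Lemma inv_one_sub_expR_le (d : R) : 0 < d <= 1 ->
  (1 - expR (- d * ln 2))^-1 <= 2 / ln 2 * d^-1.
Proof.
case/andP=> d0 d1.
have l0 : 0 < ln 2 :> R by rewrite ln_gt0// ltr1n.
have l1 : ln 2 <= 1 :> R by rewrite (le_trans (le_ln1Dx _))//; lra.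
have dl : 0 < d * ln 2 by rewrite mulr_gt0.
have dl1 : d * ln 2 <= 1 by rewrite mulr_ile1// ltW.
have e1 : expR (- d * ln 2) <= (1 + d * ln 2)^-1.
  by rewrite mulNr expRN lef_pV2 ?posrE ?expR_gt0 ?expR_ge1Dx//; lra.
have e2 : d * ln 2 / 2 <= 1 - expR (- d * ln 2).
  suff : (1 + d * ln 2)^-1 <= 1 - d * ln 2 / 2 by lra.
  rewrite -[leLHS]mul1r ler_pdivrMr; last lra.
  by nra.
have -> : 2 / ln 2 * d^-1 = (d * ln 2 / 2)^-1.
  by field; rewrite !gt_eqF.
by rewrite lef_pV2 ?posrE//; lra.
Qed.

Lemma minr_expR_le (d x y : R) : 0 <= d <= 1 -> 0 < x -> 0 < y ->
  Num.min x y <= expR ((1 - d) * ln x + d * ln y).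
Proof.
move=> /andP[d0 d1] x0 y0.
have z0 : 0 < Num.min x y by rewrite lt_min x0.
rewrite -{1}(lnK z0) ler_expR.
have lx : ln (Num.min x y) <= ln x by rewrite ler_ln// ?posrE// ge_min lexx.
have ly : ln (Num.min x y) <= ln y by rewrite ler_ln// ?posrE// ge_min lexx orbT.
by nra.
Qed.

(** Termwise, since binomial(s, k) <= s!/k!. This turns the product of s factors 1 + |ln x| into the
    truncated exponential sum of [kappa s]. *)
Lemma exprD1_le_expansion (s : nat) (y : R) : 0 <= y ->
  (1 + y) ^+ s <= (s`!)%:R * \sum_(0 <= k < s.+1) y ^+ k / (k`!)%:R.
Proof.
move=> y0; rewrite exprDn big_mkord mulr_sumr; apply: ler_sum => i _.
rewrite expr1n mul1r mulrCA -[leLHS]mulr_natr ler_wpM2l ?exprn_ge0//.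
rewrite ler_pdivlMr ?ltr0n ?fact_gt0// -natrM ler_nat.
have := @bin_fact s i (ltn_ord i); rewrite mulnA => <-.
by rewrite leq_pmulr// fact_gt0.
Qed.

Variables (s : nat) (N : 'I_s -> nat).
Hypothesis N_ge2 : forall i, (2 <= N i)%N.

Lemma exp2_le_prod (nu : 'I_s -> nat) :
  (2 ^ (\sum_i nu i) <= \prod_i N i ^ nu i)%N.
Proof.
rewrite expn_sum; apply: leq_prod => i _.
by case: (nu i) => // k; rewrite leq_exp2r.
Qed.

Lemma generated_monoid_gt0 m : generated_monoid N m -> (0 < m)%N.
Proof.
case=> nu _ <-; apply: prodn_gt0 => i.
by rewrite expn_gt0 (leq_trans _ (N_ge2 i)).
Qed.

(** Each m is charged to one of its exponent vectors; the sum over all vectors with entries below n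
    factors into s truncated geometric series. *)
Lemma sum_generated_monoid_le (F : nat -> R) (r c : R) n :
  0 <= r < 1 -> 0 <= c ->
  (forall nu : 'I_s -> nat, F (\prod_i N i ^ nu i)%N <= c * r ^+ (\sum_i nu i)) ->
  \sum_(0 <= m < n | m \in generated_monoid N) F m <= c * ((1 - r)^-1) ^+ s.
Proof.
move=> r01 c0 Fle; have /andP[r0 r1] := r01.
pose G (f : {ffun 'I_s -> 'I_n}) := \prod_i r ^+ f i.
have G0 f : 0 <= G f by apply: prodr_ge0 => i _; rewrite exprn_ge0.
apply: (@le_trans _ _ (c * \sum_f G f)); last first.
  rewrite ler_wpM2l// -(bigA_distr_bigA (fun _ (j : 'I_n) => r ^+ j))/=.
  have -> : (1 - r)^-1 ^+ s = \prod_(i < s) (1 - r)^-1.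
    by rewrite prodr_const card_ord.
  apply: ler_prod => i _; rewrite sum_geometric_le// andbT.
  by apply: sumr_ge0 => j _; rewrite exprn_ge0.
pose val_of (f : {ffun 'I_s -> 'I_n}) := (\prod_i N i ^ f i)%N.
apply: (@le_trans _ _ (c * \sum_(m < n) \sum_(f | val_of f == m) G f)); last first.
  rewrite ler_wpM2l// (exchange_big_dep predT)//=; apply: ler_sum => f _.
  case: (ltnP (val_of f) n) => [fn|nf].
    by rewrite (big_pred1 (Ordinal fn))// => j; rewrite [in RHS]eq_sym.
  rewrite big_pred0// => j; apply/negbTE; apply: contraTneq nf => ->.
  by rewrite -ltnNge.
rewrite big_mkord mulr_sumr [leRHS](bigID (fun m : 'I_n => val m \in generated_monoid N))/=.
rewrite ler_wpDr//.
  by apply: sumr_ge0 => m _; rewrite mulr_ge0// sumr_ge0.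
apply: ler_sum => m; rewrite inE => -[nu _ num].
(* The exponents fit into ['I_n] because nu_i <= 2^nu_i <= m < n. *)
have nun i : (nu i < n)%N.
  apply: leq_trans (ltn_ord m); rewrite ltnS -num.
  apply: leq_trans (exp2_le_prod nu).
  apply: (@leq_trans (2 ^ nu i)); first by rewrite ltnW// ltn_expl.
  by rewrite leq_exp2l// (bigD1 i)//= leq_addr.
pose f := [ffun i => Ordinal (nun i)].
rewrite (bigD1 f)/=; last by apply/eqP; rewrite -num; apply: eq_bigr => i _; rewrite ffunE.
rewrite mulrDr ler_wpDr// ?mulr_ge0// ?sumr_ge0//.
have -> : G f = r ^+ (\sum_i nu i).
  by rewrite -prodrXr; apply: eq_bigr => i _; rewrite ffunE.
by rewrite -num.
Qed.

(* Rankin's trick: interpolating [min x y <= x^(1-d) y^d] turns the sum over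
   the monoid into a product of [s] geometric series; [d = 1/(1+|ln x|)] costs
   only a factor [e] at [x]. *)
Lemma sum_min_le_kappa : exists2 A : R, 0 <= A &
  forall n x, 0 <= x <= 1 ->
    \sum_(0 <= m < n | m \in generated_monoid N) Num.min x m%:R^-1 <=
      A * kappa s x.
Proof.
have l0 : 0 < ln 2 :> R by rewrite ln_gt0// ltr1n.
(* The factor e bounds x^(-d) = exp(d |ln x|), each generator contributes 2 / ln 2 through its
   geometric series, and s! comes from expanding (1 + |ln x|)^s. *)
exists (expR 1 * (2 / ln 2) ^+ s * (s`!)%:R).
  by rewrite !mulr_ge0// ?expR_ge0// exprn_ge0// divr_ge0// ltW.
move=> n x /andP[x0 x1]; move: x0; rewrite le_eqVlt => /predU1P[<-|x0].
  rewrite /kappa mul0r mulr0 big1// => m _.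
  by rewrite min_l// invr_ge0.
have lx : ln x <= 0 by exact: ln_le0.
set L := `|ln x|; have LE : ln x = - L by rewrite /L ler0_norm// opprK.
have L0 : 0 <= L by exact: normr_ge0.
pose d := (1 + L)^-1.
have d0 : 0 < d by rewrite invr_gt0; lra.
have d1 : d <= 1 by rewrite invf_le1; lra.
have dL : d * L <= 1 by rewrite mulrC ler_pdivrMr; lra.
pose r := expR (- d * ln 2).
have r1 : r < 1 by rewrite expR_lt1 mulNr oppr_lt0 mulr_gt0.
have rr : 0 <= r < 1 by rewrite expR_ge0.
apply: (@le_trans _ _ (x * expR 1 * ((1 - r)^-1) ^+ s)).
  apply: sum_generated_monoid_le => // [|nu].
    by rewrite mulr_ge0// ?expR_ge0 ?ltW.
  set m := (\prod_i _)%N; set q := (\sum_i _)%N.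
  have qm : (2 ^ q <= m)%N by exact: exp2_le_prod.
  have m0 : (0 < m)%N by apply: leq_trans qm; rewrite expn_gt0.
  apply: le_trans (@minr_expR_le d x m%:R^-1 _ _ _) _ => //.
  - by rewrite ltW.
  - by rewrite invr_gt0 ltr0n.
  rewrite /r -expRM_natl -{2}(lnK x0) -!expRD ler_expR.
  have qln : q%:R * ln 2 <= ln m%:R :> R.
    rewrite mulr_natl -lnXn ?ltr0n// ler_ln ?posrE ?exprn_gt0 ?ltr0n//.
    by rewrite -natrX ler_nat.
  rewrite lnV ?posrE ?ltr0n// LE.
  have : d * (q%:R * ln 2) <= d * ln m%:R by rewrite ler_wpM2l// ltW.
  by nra.
rewrite /kappa -/L.
have e1 : (1 - r)^-1 ^+ s <= (2 / ln 2) ^+ s * (1 + L) ^+ s.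
  rewrite -exprMn; apply: lerXn2r; rewrite ?nnegrE.
  - by rewrite invr_ge0 subr_ge0 ltW.
  - by rewrite mulr_ge0// ?divr_ge0// ?ltW//; lra.
  - by rewrite -[1 + L]invrK; apply: inv_one_sub_expR_le; rewrite d0.
apply: (@le_trans _ _ (x * expR 1 * ((2 / ln 2) ^+ s *
   ((s`!)%:R * \sum_(0 <= k < s.+1) L ^+ k / (k`!)%:R)))).
  rewrite ler_wpM2l ?mulr_ge0 ?expR_ge0 ?(ltW x0)//.
  apply: (le_trans e1).
  by rewrite ler_wpM2l ?exprD1_le_expansion// exprn_ge0// divr_ge0// ltW.
by rewrite le_eqVlt; apply/orP; left; apply/eqP; ring.
Qed.

End monoid_sums.

(** * Transfer of a partition into arcs *)

Section cut_sectors.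
Variable R : realType.
Implicit Types (C : set (circle R)) (J : set R).

Lemma count_iota_le2 (p : pred nat) n :
  (forall k1 k2 k3, (k1 < k2 < k3)%N -> p k1 -> p k2 -> p k3 -> False) ->
  (count p (iota 0 n) <= 2)%N.
Proof.
move=> h; rewrite -size_filter leqNgt; apply/negP => lt.
have : sorted ltn (seq.filter p (iota 0 n)).
  by apply: sorted_filter; [exact: ltn_trans|exact: iota_ltn_sorted].
have : all p (seq.filter p (iota 0 n)) by exact: filter_all.
move: lt; case: seq.filter => [|k1 [|k2 [|k3 s]]]//= _ /and4P[p1 p2 p3 _] /and3P[l12 l23 _].
by apply: (h k1 k2 k3) => //; rewrite l12.
Qed.

Definition unit_turn : set R := [set t | 0 <= t < 1].

Definition cut (X : set R) := X !=set0 /\ ~ unit_turn `<=` X.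

(** An interval that meets two sectors contains every sector strictly between them, so only the
    first and the last one met can be cut. *)
Lemma count_cut_interval N J : is_interval J ->
  (count (fun k => `[< cut [set u : R | unit_turn u /\ J ((u + k%:R) / N%:R)] >])
     (iota 0 N) <= 2)%N.
Proof.
case: N => [|N]// iJ; set n := N.+1.
have n0 : 0 < n%:R :> R by rewrite ltr0n.
apply: count_iota_le2 => k1 k2 k3 /andP[k12 k23].
move=> /asboolP[[w1 [/andP[w10 w11] J1]] _] /asboolP[_ h2] /asboolP[[w3 [/andP[w30 w31] J3]] _].
apply: h2 => u /andP[u0 u1]; split; first by rewrite /unit_turn/= u0.
apply: iJ J1 J3 _ _; rewrite !ler_pM2r ?invr_gt0//.
have l12 : k1.+1%:R <= k2%:R :> R by rewrite ler_nat.
have l23 : k2.+1%:R <= k3%:R :> R by rewrite ler_nat.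
by move: l12 l23; rewrite -!natr1 => ? ?; apply/andP; split; lra.
Qed.

(** 4 is two cut sectors for each of the two intervals of [C]. A sector cut by [C] is cut by the
    interval that meets it, since a point missed by [C] is missed by both. *)
Lemma sum_cut_fiber_le N C : Defs.arc C ->
  \sum_(k < N) (`[< cut (fiber N k C) >]%:R : R) <= 4.
Proof.
move=> /arc_angle_set[J1 [J2 [i1 i2 _ CJ]]].
pose p J k := `[< cut [set u : R | unit_turn u /\ J ((u + k%:R) / N%:R)] >].
have sumE J : \sum_(k < N) (p J k)%:R = (count (p J) (iota 0 N))%:R :> R.
  rewrite -sum1_count natr_sum -(big_mkord xpredT (fun k => (p J k)%:R)).
  by rewrite /index_iota subn0 [RHS]big_mkcond; apply: eq_bigr => k _; case: ifP.
apply: (@le_trans _ _ (\sum_(k < N) ((p J1 k)%:R + (p J2 k)%:R))).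
  apply: ler_sum => k _; rewrite -natrD ler_nat.
  case: asboolP => // -[[u uC] Cn].
  have [v v01 vC] : exists2 v, unit_turn v & ~ fiber N k C v.
    by apply: contrapT => h; apply: Cn => v v01; apply: contrapT => vC; apply: h; exists v.
  move: uC vC; rewrite fiberE// CJ => -[u01 uJ] vC.
  have vJ J : (J `<=` J1 `|` J2) ->
      ~ unit_turn `<=` [set u : R | unit_turn u /\ J ((u + k%:R) / N%:R)].
    by move=> JJ /(_ _ v01)[_ /JJ vJ]; apply: vC.
  case: uJ => uJ.
    have -> : p J1 k; last by [].
    by apply/asboolP; split; [exists u|apply: vJ; left].
  have -> : p J2 k; last by rewrite addn1.
  by apply/asboolP; split; [exists u|apply: vJ; right].
rewrite big_split/= !sumE -natrD ler_nat.
by rewrite (@leq_add _ _ 2 2)//; exact: count_cut_interval.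
Qed.

Lemma is_interval_unit_turn : is_interval unit_turn.
Proof.
by move=> x y /andP[x0 x1] /andP[y0 y1] z /andP[xz zy]; apply/andP; split; lra.
Qed.

Lemma measurable_unit_turn : measurable unit_turn.
Proof. exact: is_interval_measurable is_interval_unit_turn. Qed.

End cut_sectors.

Arguments unit_turn {R}.

(** * Length of arcs and sectors *)

Section length.
Variable R : realType.
Implicit Types (A B : set R) (C : set (circle R)).

(** Intersecting with [unit_turn] keeps the Lebesgue measure finite, so that [fine] preserves
    additivity. *)
Definition len A : R := fine (lebesgue_measure (A `&` unit_turn)).

Lemma unit_turnE : unit_turn = `[0, 1[%classic :> set R.
Proof. by apply/seteqP; split=> t; rewrite /unit_turn/= in_itv. Qed.

Lemma lebesgue_unit_turn_fin A : measurable A ->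
  lebesgue_measure (A `&` unit_turn) \is a fin_num.
Proof.
move=> mA; rewrite ge0_fin_numE//.
have mI := @measurable_unit_turn R.
apply: (@le_lt_trans _ _ (lebesgue_measure (unit_turn))).
  by apply: le_measure; rewrite ?inE//; exact: measurableI.
by rewrite unit_turnE lebesgue_measure_itv/= lte01 oppr0 adde0 ltry.
Qed.

Lemma len_additive : finitely_additive len.
Proof.
split=> [|A B mA mB AB]; first by rewrite /len set0I measure0.
have mI := @measurable_unit_turn R.
rewrite /len setIUl measureU//; first by rewrite fineD// lebesgue_unit_turn_fin.
- exact: measurableI.
- exact: measurableI.
- by rewrite setIACA AB set0I.
Qed.

Lemma len_ge0 A : 0 <= len A.
Proof. exact: fine_ge0. Qed.

Lemma len_itv (a b : R) : 0 <= a <= b -> b <= 1 -> len `[a, b[%classic = b - a.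
Proof.
move=> /andP[a0 ab] b1; rewrite /len setIidl; last first.
  by move=> t /=; rewrite in_itv/= => /andP[? ?]; apply/andP; split; lra.
rewrite lebesgue_measure_itv/= lte_fin; case: ltP => //= ba.
by apply/esym/eqP; rewrite subr_eq0 eq_le ab ba.
Qed.

Lemma arc_lengthE C : arc_length C = len (angle_set C).
Proof.
rewrite /arc_length /len setIidl; last by move=> t [].
by congr (fine (lebesgue_measure _)); apply/seteqP; split=> t; rewrite /angle_set/= in_itv.
Qed.

Lemma additive_monotone (g : set R -> R) A B : finitely_additive g ->
  (forall D, 0 <= g D) -> measurable A -> measurable B -> A `<=` B -> g A <= g B.
Proof.
move=> [_ gU] g0 mA mB AB; rewrite -(setDUK AB) gU.
- by rewrite lerDl.
- by [].
- exact: measurableD.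
- exact: setDIK.
Qed.

Lemma len_unit_turn : len (unit_turn) = 1.
Proof. by rewrite unit_turnE len_itv ?subr0// lexx ler01. Qed.

Lemma arc_length01 C : Defs.arc C -> 0 <= arc_length C <= 1.
Proof.
move=> aC; rewrite arc_lengthE len_ge0/= -len_unit_turn.
apply: additive_monotone; [exact: len_additive|exact: len_ge0| | |].
- exact: measurable_angle_set.
- exact: measurable_unit_turn.
- by move=> t [].
Qed.

Definition sector_angles N k : set R := `[k%:R / N%:R, k.+1%:R / N%:R[%classic.

Lemma len_sector N k : (k < N)%N -> len (sector_angles N k) = N%:R^-1.
Proof.
move=> kN; have N0 : 0 < N%:R :> R by rewrite ltr0n (leq_ltn_trans _ kN).
rewrite len_itv; first by rewrite -mulrBl -natr1 addrAC subrr add0r mul1r.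
  by rewrite divr_ge0//= ler_pM2r ?invr_gt0// ler_nat.
by rewrite ler_pdivrMr// mul1r ler_nat.
Qed.

Lemma sector_angles_fiber N k C t : (k < N)%N -> angle_set C t ->
  sector_angles N k t -> fiber N k C !=set0.
Proof.
move=> kN; have N0 : 0 < N%:R :> R by rewrite ltr0n (leq_ltn_trans _ kN).
move=> [t01 Ct]; rewrite /sector_angles/= in_itv/= ler_pdivrMr// ltr_pdivlMr//.
rewrite -natr1 => /andP[t1 t2]; exists (t * N%:R - k%:R).
split; first by apply/andP; split; lra.
by rewrite subrK mulfK// gt_eqF.
Qed.

Lemma sum_len_sectors N (A : set R) : (0 < N)%N -> measurable A ->
  A `<=` unit_turn -> \sum_(k < N) len (A `&` sector_angles N k) = len A.
Proof.
move=> N0 mA A01; have N0' : 0 < N%:R :> R by rewrite ltr0n.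
rewrite -(@finitely_additive_bigcup _ len 'I_N (fun k => A `&` sector_angles N k) predT).
- congr len; apply/seteqP; split=> [t [k _ []]//|t At].
  have /andP[t0 t1] := A01 _ At.
  have tN0 : 0 <= t * N%:R by rewrite mulr_ge0// ltW.
  have /andP[h1 h2] := truncn_itv tN0.
  have kN : (Num.truncn (t * N%:R) < N)%N.
    rewrite -(ltr_nat R) (le_lt_trans h1)// gtr_pMl//.
  exists (Ordinal kN) => //; split=> //=.
  by rewrite /sector_angles/= in_itv/= ler_pdivrMr// ltr_pdivlMr// h1.
- exact: len_additive.
- by move=> k; apply: measurableI => //; exact: measurable_itv.
- move=> i j _ _ [t [[_ ti] [_ tj]]]; apply/val_inj/eqP.
  move: ti tj; rewrite /sector_angles/= !in_itv/= !ler_pdivrMr// !ltr_pdivlMr//.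
  move=> /andP[i1 i2] /andP[j1 j2]; rewrite eqn_leq.
  have := le_lt_trans i1 j2; have := le_lt_trans j1 i2.
  by rewrite !ltr_nat !ltnS => -> ->.
Qed.

End length.

(** * Estimates for a fixed N *)

Section transfer_estimates.
Variable R : realType.
Variables g nu : set R -> R.
Hypotheses (ag : finitely_additive g) (anu : finitely_additive nu).
Hypothesis nu_ge0 : forall A, 0 <= nu A.
Hypothesis g_le : forall A, measurable A -> `|g A| <= nu A.
Hypothesis g_unit : g (unit_turn) = 0.
Implicit Types C : set (circle R).

Let M := nu (unit_turn).

Lemma uncut_fiber N k C : (k < N)%N -> ~ cut (fiber N k C) -> g (fiber N k C) = 0.
Proof.
move=> kN nc; have [->|/set0P f0] := eqVneq (fiber N k C) set0; first by case: ag.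
suff -> : fiber N k C = unit_turn by [].
apply/seteqP; split=> [|]; first exact: fiber01.
by apply: contrapT => h; apply: nc.
Qed.

Lemma nu_fiber_le N k C : (k < N)%N -> Defs.arc C -> nu (fiber N k C) <= M.
Proof.
move=> kN aC; apply: additive_monotone => //.
- exact: measurable_fiber.
- exact: measurable_unit_turn.
- exact: fiber01.
Qed.

Lemma transfer_le N C : Defs.arc C -> `|transfer g N C| <= 4 * M * N%:R^-1.
Proof.
move=> aC; rewrite /transfer normrM ger0_norm ?invr_ge0// mulrC ler_wpM2r ?invr_ge0//.
apply: (le_trans (ler_norm_sum _ _ _)); rewrite big_mkord.
apply: (@le_trans _ _ (\sum_(k < N) `[< cut (fiber N k C) >]%:R * M)).
  apply: ler_sum => k _; case: asboolP => [_|nc].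
    by rewrite mul1r (le_trans (g_le _)) ?nu_fiber_le//; exact: measurable_fiber.
  by rewrite uncut_fiber// normr0 mul0r.
by rewrite -mulr_suml ler_wpM2r ?sum_cut_fiber_le//; exact: nu_ge0.
Qed.

Section partition.
Variables (n : nat) (C : 'I_n -> set (circle R)) (N : nat).
Hypotheses (N_gt0 : (0 < N)%N) (CT : arc_decomposition setT C).

Let large (j : 'I_n) := N%:R^-1 <= arc_length (C j).

(** The right-hand side replaces the indicator of meeting a short arc by terms that can be summed
    over k: if a long arc cuts the sector, the second sum is at least 1; otherwise short arcs fill
    it and the first term is N times 1/N. *)
Lemma small_meets_le (k : 'I_N) j0 : ~~ large j0 -> fiber N k (C j0) !=set0 ->
  1 <= N%:R * \sum_(j < n | ~~ large j) len (angle_set (C j) `&` sector_angles N k) +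
       \sum_(j < n | large j) (`[< cut (fiber N k (C j)) >]%:R : R).
Proof.
move=> sj0 [u0 [u001 fu0]]; have [aC tC CU] := CT.
have N0 : 0 < N%:R :> R by rewrite ltr0n.
have [[j lj cj]|nocut] := pselect (exists2 j, large j & cut (fiber N k (C j))).
  rewrite ler_wpDl//.
    by rewrite mulr_ge0//; apply: sumr_ge0 => i _; exact: len_ge0.
  rewrite (bigD1 j)//= asboolT// ler_wpDr//.
  exact: sumr_ge0.
rewrite ler_wpDr//; first exact: sumr_ge0.
have <- : \sum_(j < n) len (angle_set (C j) `&` sector_angles N k) =
          \sum_(j < n | ~~ large j) len (angle_set (C j) `&` sector_angles N k).
  rewrite (bigID large)/= big1 ?add0r// => j lj.
  rewrite (_ : _ `&` _ = set0); first by case: (len_additive R).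
  rewrite -subset0 => t [Ct /(sector_angles_fiber (ltn_ord k) Ct) fj].
  (* A long arc that meets the sector without cutting it contains all of it, hence also a point of
     the short arc [C j0], against disjointness. *)
  have fT : unit_turn `<=` fiber N k (C j).
    by apply: contrapT => h; apply: nocut; exists j.
  have [_ fju] := fT _ u001.
  have ij : j = j0 by apply: tC => //; eexists; split; [exact: fju|exact: fu0].
  by move: sj0; rewrite -ij lj.
rewrite -(@finitely_additive_bigcup _ (@len R) 'I_n
  (fun j => angle_set (C j) `&` sector_angles N k) predT); last 3 first.
- exact: len_additive.
- move=> j; apply: measurableI; [exact: measurable_angle_set|exact: measurable_itv].
- move=> i j _ _ [t [[[_ Ci] _] [[_ Cj] _]]].
  by apply: tC => //; exists (turn t).
have -> : \bigcup_(j in [set` @predT 'I_n]) (angle_set (C j) `&` sector_angles N k) =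
   sector_angles N k.
  apply/seteqP; split=> [t [j _ []]//|t tk].
  have : [set: circle R] (turn t) by [].
  rewrite -CU => -[j _ Cj]; exists j => //; split=> //; split=> //.
  move: tk; rewrite /sector_angles/= in_itv/= => /andP[t1 t2].
  rewrite (le_trans _ t1) ?divr_ge0//= (lt_le_trans t2)//.
  by rewrite ler_pdivrMr// mul1r ler_nat.
by rewrite len_sector// divff// gt_eqF.
Qed.

(** 8 = 4 + 4: a long arc costs 4 M / N by itself, and again 4 M / N for the short arcs in the at
    most four sectors that it cuts. The remaining short arcs cost M times their length. *)
Lemma sum_transfer_partition_le :
  \sum_(j < n) `|transfer g N (C j)| <=
    8 * M * \sum_(j < n) Num.min (arc_length (C j)) N%:R^-1.
Proof.
have [aC tC CU] := CT.
have N0 : 0 < N%:R :> R by rewrite ltr0n.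
have M0 : 0 <= M by exact: nu_ge0.
have Ninv0 : 0 <= N%:R^-1 :> R by rewrite invr_ge0 ltW.
rewrite (bigID large) [X in _ <= _ * X](bigID large)/=.
have -> : \sum_(j < n | large j) Num.min (arc_length (C j)) N%:R^-1 =
    \sum_(j < n | large j) N%:R^-1 by apply: eq_bigr => j lj; rewrite min_r.
have -> : \sum_(j < n | ~~ large j) Num.min (arc_length (C j)) N%:R^-1 =
    \sum_(j < n | ~~ large j) arc_length (C j).
  by apply: eq_bigr => j lj; rewrite min_l// ltW// ltNge.
set La := \sum_(j < n | large j) N%:R^-1; set Sm := \sum_(j < n | ~~ large j) arc_length _.
have Sm0 : 0 <= Sm by apply: sumr_ge0 => j _; case/andP: (arc_length01 (aC j)).
have hL : \sum_(j < n | large j) `|transfer g N (C j)| <= 4 * M * La.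
  by rewrite mulr_sumr; apply: ler_sum => j _; exact: transfer_le.
suff hS : \sum_(j < n | ~~ large j) `|transfer g N (C j)| <= M * (Sm + 4 * La).
  have : 0 <= M * Sm by rewrite mulr_ge0.
  by lra.
have mf (k : 'I_N) j : measurable (fiber N k (C j)) by exact: measurable_fiber.
pose mixed (k : 'I_N) :=
  N%:R * \sum_(j < n | ~~ large j) len (angle_set (C j) `&` sector_angles N k) +
       \sum_(j < n | large j) (`[< cut (fiber N k (C j)) >]%:R : R).
(* The fibers of the short arcs in sector k are disjoint, so their [nu]-masses add up to at most M,
   whatever their number. *)
have hk (k : 'I_N) : \sum_(j < n | ~~ large j) nu (fiber N k (C j)) <= M * mixed k.
  have [[j0 sj0 fj0]|none] := pselect (exists2 j0, ~~ large j0 & fiber N k (C j0) !=set0).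
    rewrite -(@finitely_additive_bigcup _ nu 'I_n (fun j => fiber N k (C j))
      (fun j => ~~ large j))//; last first.
      move=> i j _ _ [t [[_ Ci] [_ Cj]]]; apply: tC => //.
      by eexists; split; [exact: Ci|exact: Cj].
    apply: (@le_trans _ _ M).
      apply: additive_monotone => //; last by move=> t [j _ []].
        by apply: fin_bigcup_measurable => //; exact: finite_finset.
      exact: measurable_unit_turn.
    by rewrite ler_peMr//; exact: small_meets_le fj0.
  rewrite big1 => [|j sj]; last first.
    suff -> : fiber N k (C j) = set0 by case: anu.
    by apply/eqP/negPn/negP => /set0P fj; apply: none; exists j.
  rewrite mulr_ge0// addr_ge0//; last exact: sumr_ge0.
  by rewrite mulr_ge0 ?(ltW N0)//; apply: sumr_ge0 => i _; exact: len_ge0.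
apply: (@le_trans _ _ (N%:R^-1 * \sum_(k < N) M * mixed k)).
  apply: (@le_trans _ _ (N%:R^-1 * \sum_(k < N) \sum_(j < n | ~~ large j) nu (fiber N k (C j)))).
    rewrite exchange_big/= mulr_sumr; apply: ler_sum => j _.
    rewrite /transfer normrM ger0_norm// ler_wpM2l// big_mkord.
    by apply: (le_trans (ler_norm_sum _ _ _)); apply: ler_sum => k _; exact: g_le.
  by rewrite ler_wpM2l//; apply: ler_sum => k _; exact: hk.
rewrite -mulr_sumr mulrCA ler_wpM2l// /mixed big_split/= mulrDr lerD//.
  rewrite -mulr_sumr mulrA mulVf ?gt_eqF// mul1r exchange_big/=.
  rewrite le_eqVlt; apply/orP; left; apply/eqP; apply: eq_bigr => j _.
  rewrite arc_lengthE sum_len_sectors//; first exact: measurable_angle_set.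
  by move=> t [].
rewrite exchange_big/= /La !mulr_sumr; apply: ler_sum => j _.
by rewrite mulrC ler_wpM2r// sum_cut_fiber_le.
Qed.

End partition.
End transfer_estimates.

(** * The series Psi *)

Section series.
Variable R : realType.
Implicit Types (u b : nat -> R) (S : set nat).

Lemma bounded_sum_cvg u S (B : R) :
  (forall n, \sum_(0 <= k < n | k \in S) `|u k| <= B) ->
  cvgn (fun n => \sum_(0 <= k < n | k \in S) u k).
Proof.
move=> uB; pose v k := if k \in S then u k else 0.
have -> : (fun n => \sum_(0 <= k < n | k \in S) u k) = series v.
  by apply/funext => n; rewrite seriesEnat big_mkcond.
apply: normed_cvg; apply: nondecreasing_is_cvgn.
  apply/nondecreasing_seqP => n. by rewrite /= seriesSr lerDl.
exists B => _ [n _ <-]; rewrite /= seriesEnat; apply: le_trans (uB n).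
rewrite [leRHS]big_mkcond/= le_eqVlt; apply/orP; left; apply/eqP.
by apply: eq_bigr => k _; rewrite /v; case: ifP; rewrite ?normr0.
Qed.

Lemma cvg_sum_seq (I : Type) (r : seq I) (P : pred I) (f : I -> nat -> R) (l : I -> R) :
  (forall i, P i -> f i n @[n --> \oo] --> l i) ->
  \sum_(i <- r | P i) f i n @[n --> \oo] --> \sum_(i <- r | P i) l i.
Proof.
move=> fl; elim: r => [|i r IH].
  by rewrite big_nil; under eq_fun do rewrite big_nil; exact: cvg_cst.
rewrite big_cons; under eq_fun do rewrite big_cons.
case: ifP => // Pi; exact: cvgD (fl i Pi) IH.
Qed.

(** Dominated convergence for series (Tannery): the cutoff [K] depends on the majorant [b] alone, so
    the tail bound is uniform in m and only finitely many terms need their limits. *)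
Lemma dominated_sum_cvg0 (u : nat -> nat -> R) b S (B : R) :
  (forall m k, k \in S -> `|u m k| <= b k) ->
  (forall n, \sum_(0 <= k < n | k \in S) b k <= B) ->
  (forall k, k \in S -> u m k @[m --> \oo] --> 0) ->
  limn (fun n => \sum_(0 <= k < n | k \in S) u m k) @[m --> \oo] --> (0 : R).
Proof.
move=> ub bB u0.
have b0 k : k \in S -> 0 <= b k by move=> kS; exact: le_trans (ub 0%N k kS).
have cb : cvgn (fun n => \sum_(0 <= k < n | k \in S) b k).
  apply: (@bounded_sum_cvg _ _ B) => n; apply: le_trans (bB n).
  by apply: ler_sum => k kS; rewrite ger0_norm// b0.
have cu m : cvgn (fun n => \sum_(0 <= k < n | k \in S) u m k).
  apply: (@bounded_sum_cvg _ _ B) => n; apply: le_trans (bB n).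
  by apply: ler_sum => k kS; exact: ub.
apply/cvgrPdist_lt => e e0; have e20 : 0 < e / 2 by rewrite divr_gt0.
set l := limn (fun n => \sum_(0 <= k < n | k \in S) b k) in cb *.
have [K _ hK] : \forall n \near \oo, `|l - \sum_(0 <= k < n | k \in S) b k| < e / 2.
  by have /cvgrPdist_lt := cb; exact.
have bl n : \sum_(0 <= k < n | k \in S) b k <= l.
  apply: nondecreasing_cvgn_le cb _; apply/nondecreasing_seqP => i.
  by rewrite [leRHS]big_mkcond big_nat_recr//= -big_mkcond/= lerDl; case: ifP => // /b0.
have tail m n : (K <= n)%N -> `|\sum_(0 <= k < n | k \in S) u m k| <=
    `|\sum_(0 <= k < K | k \in S) u m k| + e / 2.
  move=> Kn; rewrite (big_cat_nat _ Kn)//=; apply: (le_trans (ler_normD _ _)).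
  rewrite lerD2l; apply: (@le_trans _ _ (\sum_(K <= k < n | k \in S) b k)).
    by apply: (le_trans (ler_norm_sum _ _ _)); apply: ler_sum => k kS; exact: ub.
  have := hK K (leqnn K); rewrite ger0_norm ?subr_ge0// => h.
  by have := bl n; rewrite (big_cat_nat _ Kn)//=; lra.
have /cvgrPdist_lt/(_ _ e20) : \sum_(0 <= k < K | k \in S) u m k @[m --> \oo] -->
    \sum_(0 <= k < K | k \in S) (0 : R) by apply: cvg_sum_seq.
apply: filterS => m; rewrite big1// !sub0r !normrN => hm.
apply: (@le_lt_trans _ _ (`|\sum_(0 <= k < K | k \in S) u m k| + e / 2)); last by lra.
rewrite -(cvg_lim _ (cvg_norm (cu m)))//.
apply: limr_le; first by apply: is_cvg_norm; exact: cu.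
by exists K => // n /= Kn; exact: tail.
Qed.

End series.

(** * The charge in angle coordinates and its total variation *)

Section mass.
Variable R : realType.
Variable sigma : borel_charge R.

Definition mass (B : set R) : R := fine (sigma (@angle R @^-1` B)).

Let measurable_preimage_angle (B : set R) : measurable B ->
  measurable ((@angle R : g_sigma_algebraType (@open (circle R)) -> R) @^-1` B).
Proof. by move=> mB; rewrite -[X in measurable X]setTI; exact: measurable_angle. Qed.

Lemma premeas_mass C : premeas sigma C = mass (angle_set C).
Proof. by rewrite /premeas /mass preimage_angle_set. Qed.

Lemma mass_additive : finitely_additive mass.
Proof.
split=> [|A B mA mB AB]; first by rewrite /mass preimage_set0 charge0.
rewrite /mass preimage_setU chargeU ?fineD//.
- by apply: fin_num_measure; exact: measurable_preimage_angle.
- by apply: fin_num_measure; exact: measurable_preimage_angle.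
- exact: measurable_preimage_angle.
- exact: measurable_preimage_angle.
- by rewrite -preimage_setI AB preimage_set0.
Qed.

Lemma mass_unit_turn : M0 sigma -> mass unit_turn = 0.
Proof.
rewrite /M0/= /mass => s0; rewrite (_ : _ @^-1` _ = setT) ?s0//.
by apply/seteqP; split=> z // _; case: (angleP z).
Qed.

(** The witness is the total variation of [sigma], transported by [angle]; as a finite measure it is
    continuous from above, which is the last clause. *)
Lemma mass_dominated : exists nu : set R -> R,
  [/\ finitely_additive nu, forall A, 0 <= nu A,
     forall A, measurable A -> `|mass A| <= nu A &
     forall F : nat -> set R, (forall n, measurable (F n)) ->
       (forall n, F n.+1 `<=` F n) -> \bigcap_n F n = set0 ->
       nu (F n) @[n --> \oo] --> (0 : R)].
Proof.
have [P [N hd]] := Hahn_decomposition sigma.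
pose mu : {measure set (g_sigma_algebraType (@open (circle R))) -> \bar R} :=
  charge_variation hd.
have mu_fin A : measurable A -> mu (@angle R @^-1` A) \is a fin_num.
  move=> mA; rewrite /mu; apply: (fin_num_measure (charge_variation hd)).
  exact: measurable_preimage_angle.
exists (fun B => fine (mu (@angle R @^-1` B))); split.
- split=> [|A B mA mB AB]; first by rewrite preimage_set0 measure0.
  rewrite preimage_setU -fineD ?mu_fin//; congr fine.
  apply: measureU; try exact: measurable_preimage_angle.
  by rewrite -preimage_setI AB preimage_set0.
- by move=> A; exact: fine_ge0.
- move=> A mA; rewrite /mass -lee_fin -abse_EFin !fineK ?mu_fin//.
    by apply: abse_charge_variation; exact: measurable_preimage_angle.
  by apply: fin_num_measure; exact: measurable_preimage_angle.
- move=> F mF dF F0.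
  have : mu (@angle R @^-1` (F n)) @[n --> \oo] --> (0 : R)%:E.
    have <- : mu (\bigcap_n (@angle R @^-1` (F n))) = (0 : R)%:E.
      by rewrite -preimage_bigcap F0 preimage_set0 measure0.
    apply: nonincreasing_cvg_mu.
    + by rewrite -ge0_fin_numE// mu_fin.
    + by move=> n; exact: measurable_preimage_angle.
    + by apply: bigcapT_measurable => n; exact: measurable_preimage_angle.
    + by apply/nonincreasing_seqP => n; apply/subsetPset => z; exact: dF.
  by move/fine_cvg.
Qed.

End mass.

(** * [Psi] as a premeasure of bounded variation *)

Section Psi_premeasure.
Variable R : realType.
Variables (sigma : borel_charge R) (S : set nat) (B : R).
Hypothesis sigma0 : M0 sigma.
Hypothesis S_inv : forall n, \sum_(0 <= N < n | N \in S) N%:R^-1 <= B.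
Implicit Types C : set (circle R).

Local Notation tr := (transfer (mass sigma)).

Lemma pull_premeas N C : Defs.arc C -> pull N (premeas sigma) C = tr N C.
Proof.
by move=> aC; apply: pull_transfer => //; [exact: mass_additive|move=> D _; exact: premeas_mass].
Qed.

Lemma PsiE C : Defs.arc C ->
  Psi S sigma C = limn (fun n => \sum_(0 <= N < n | N \in S) tr N C).
Proof.
move=> aC; rewrite /Psi; congr (limn _); apply/funext => n.
by apply: eq_bigr => N _; rewrite pull_premeas.
Qed.

Lemma transfer_bound : exists2 K : R, 0 <= K &
  forall N C, Defs.arc C -> `|tr N C| <= K * N%:R^-1.
Proof.
have [nu [anu nu0 gnu _]] := mass_dominated sigma.
exists (4 * nu unit_turn); first by rewrite mulr_ge0.
by move=> N C; apply: transfer_le => //; [exact: mass_additive|exact: mass_unit_turn].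
Qed.

Lemma sum_transfer_cvg C : Defs.arc C ->
  cvgn (fun n => \sum_(0 <= N < n | N \in S) tr N C).
Proof.
have [K K0 hK] := transfer_bound.
move=> aC; apply: (@bounded_sum_cvg _ _ _ (K * B)) => n.
apply: (@le_trans _ _ (K * \sum_(0 <= N < n | N \in S) N%:R^-1)).
  by rewrite mulr_sumr; apply: ler_sum => N _; exact: hK.
by rewrite ler_wpM2l.
Qed.

Lemma transfer_decomposition N A n (C : 'I_n -> set (circle R)) :
  arc_decomposition A C -> tr N A = \sum_(j < n) tr N (C j).
Proof.
move=> [aC tC <-]; rewrite /transfer -mulr_sumr exchange_big/=; congr (_ * _).
rewrite big_nat [RHS]big_nat; apply: eq_bigr => k /andP[_ kN].
rewrite -(@finitely_additive_bigcup _ _ 'I_n (fun j => fiber N k (C j)) predT).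
- congr (mass _ _); apply/seteqP; split=> [u [u01 [j _ Cu]]|u [j _ [u01 Cu]]].
    by exists j.
  by split=> //; exists j.
- exact: mass_additive.
- by move=> j; exact: measurable_fiber.
- move=> i j _ _ [u [[_ Ci] [_ Cj]]]; apply: tC => //.
  by eexists; split; [exact: Ci|exact: Cj].
Qed.

(** The finite sum over a decomposition commutes with the limit, and each transfer is additive over
    it, so all decompositions agree. This makes [push] of [Psi] computable. *)
Lemma ext_Psi A : decomposable A ->
  ext (Psi S sigma) A = limn (fun n => \sum_(0 <= N < n | N \in S) tr N A).
Proof.
move=> dA; apply: ext_eq => // n C AC; have [aC _ _] := AC.
under eq_bigr do rewrite PsiE//.
apply/esym/cvg_lim => //.
have -> : (fun m => \sum_(0 <= N < m | N \in S) tr N A) =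
  (fun m => \sum_(j < n) \sum_(0 <= N < m | N \in S) tr N (C j)).
  apply/funext => m; rewrite exchange_big/=; apply: eq_bigr => N _.
  exact: transfer_decomposition.
by apply: cvg_sum_seq => j _; exact: sum_transfer_cvg.
Qed.

Lemma arc_setT : Defs.arc [set: circle R].
Proof.
have -> : [set: circle R] = turn @` (unit_turn : set R).
  by apply/seteqP; split=> // z _; have [t t01 tz] := turn_surj z; exists t.
exact/arc_turn/is_interval_unit_turn.
Qed.

Lemma transfer_setT N : tr N [set: circle R] = 0.
Proof.
rewrite /transfer big1 ?mulr0// => k _.
rewrite (_ : fiber _ _ _ = unit_turn) ?mass_unit_turn//.
by apply/seteqP; split=> u //; case.
Qed.

Lemma Psi_premeasure : premeasure (Psi S sigma).
Proof.
have [m0 mU] := mass_additive sigma.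
have lim0 (u : nat -> R) : (forall n, u n = 0) -> limn u = 0.
  by move=> u0; rewrite (_ : u = fun=> 0) ?lim_cst//; exact/funext.
split.
- rewrite PsiE; last exact: connected0.
  apply: lim0 => n; rewrite big1// => N _; rewrite /transfer big1 ?mulr0// => k _.
  by rewrite (_ : fiber _ _ _ = set0)// -subset0 => u [].
- by rewrite PsiE ?lim0//; [move=> n; rewrite big1// => N _; exact: transfer_setT|exact: arc_setT].
- move=> C1 C2 a1 a2 a12 C12; rewrite !PsiE// -limD; try exact: sum_transfer_cvg.
  congr (limn _); apply/funext => n; rewrite fctE -big_split/=; apply: eq_bigr => N _.
  rewrite /transfer -mulrDr -big_split/=; congr (_ * _).
  rewrite big_nat [RHS]big_nat; apply: eq_bigr => k /andP[_ kN].
  rewrite -mU; try exact: measurable_fiber.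
    congr (mass _ _); apply/seteqP; split=> [u [u01 [|]]|u [[u01 ?]|[u01 ?]]].
    + by left.
    + by right.
    + by split=> //; left.
    + by split=> //; right.
  move: C12; rewrite -!subset0 => C12 u [[_ u1] [_ u2]].
  by apply: C12; split; [exact: u1|exact: u2].
- move=> C aC dC C0.
  have [K K0 hK] := transfer_bound.
  have [nu [_ _ gnu nuc]] := mass_dominated sigma.
  under eq_fun do rewrite PsiE//.
  (* The majorant K / N holds for all arcs at once; for fixed N the fibers decrease to the empty
     set, and their variation tends to 0. *)
  apply: (@dominated_sum_cvg0 _ (fun m N => tr N (C m)) (fun N => K * N%:R^-1) S (K * B)).
  + by move=> m N _; exact: hK.
  + by move=> n; rewrite -mulr_sumr ler_wpM2l.
  + move=> N _.
    suff h : \sum_(0 <= k < N | (0 <= k < N)%N) mass sigma (fiber N k (C m))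
        @[m --> \oo] --> \sum_(0 <= k < N | (0 <= k < N)%N) (0 : R).
      have c : (N%:R^-1 : R) @[_ --> \oo] --> (N%:R^-1 : R) by exact: cvg_cst.
      have := cvgM c h; rewrite big1// mulr0.
      rewrite (_ : _ \* _ = fun m => tr N (C m)); first exact.
      by apply/funext => m; rewrite /transfer [in RHS]big_nat.
    apply: cvg_sum_seq => k /andP[_ kN].
    have fnu : nu (fiber N k (C m)) @[m --> \oo] --> (0 : R).
      apply: nuc.
      - by move=> m; exact: measurable_fiber.
      - by move=> m u [u01 Cu]; split=> //; exact: dC.
      - rewrite -subset0 => u hu.
        have : (\bigcap_m C m) (turn ((u + k%:R) / N%:R)) by move=> m _; case: (hu m I).
        by rewrite C0.
    apply/norm_cvg0P; apply: (squeeze_cvgr _ (cvg_cst 0) fnu).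
    by apply: nearW => m; rewrite normr_ge0/= gnu//; exact: measurable_fiber.
Qed.

Lemma Psi_P_kappa s (A : R) : 0 <= A ->
  (forall n (x : R), 0 <= x <= 1 ->
    \sum_(0 <= N < n | N \in S) Num.min x N%:R^-1 <= A * kappa s x) ->
  (forall N, N \in S -> (0 < N)%N) -> P_kappa s (Psi S sigma).
Proof.
move=> A0 hA S0; split; first exact: Psi_premeasure.
have [nu [anu nu0 gnu _]] := mass_dominated sigma.
exists (8 * nu unit_turn * A); first by rewrite !mulr_ge0.
move=> n C CT; have [aC _ _] := CT.
have cv : \sum_(j < n) `|\sum_(0 <= N < m | N \in S) tr N (C j)| @[m --> \oo] -->
    \sum_(j < n) `|Psi S sigma (C j)|.
  apply: cvg_sum_seq => j _; apply: cvg_norm; rewrite PsiE//; exact: sum_transfer_cvg.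
rewrite -(cvg_lim _ cv)//; apply: limr_le; first by apply/cvg_ex; eexists; exact: cv.
apply: nearW => m.
apply: (@le_trans _ _ (\sum_(j < n) \sum_(0 <= N < m | N \in S) `|tr N (C j)|)).
  by apply: ler_sum => j _; exact: ler_norm_sum.
(* The order of summation matters: the partition estimate needs all arcs for one N, the monoid
   estimate all N for one arc. *)
rewrite exchange_big/=.
apply: (@le_trans _ _ (\sum_(0 <= N < m | N \in S) (8 * nu unit_turn *
    \sum_(j < n) Num.min (arc_length (C j)) N%:R^-1))).
  apply: ler_sum => N NS; apply: sum_transfer_partition_le => //.
  - exact: mass_additive.
  - exact: mass_unit_turn.
  - exact: S0.
rewrite -mulr_sumr -[leRHS]mulrA ler_wpM2l ?mulr_ge0// exchange_big/= mulr_sumr.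
by apply: ler_sum => j _; apply: hA; exact: arc_length01.
Qed.

(** The fiber of a point is empty or a single angle, because [phi N] is injective on each sector; so
    every transfer is a multiple of a sum of masses of points. *)
Lemma Psi_atomless : atomless (premeas sigma) -> atomless (Psi S sigma).
Proof.
move=> s0 z.
have [t /andP[t0 t1] tz] := turn_surj z.
have az : Defs.arc [set z] by exact: connected1.
rewrite PsiE// (_ : (fun n => _) = fun=> 0) ?lim_cst//; apply/funext => n.
rewrite big1// => N _; rewrite /transfer big_nat big1 ?mulr0// => k /andP[_ kN].
have [->|/set0P[u0 [u001 fu0]]] := eqVneq (fiber N k [set z]) set0.
  by case: (mass_additive sigma).
have N0 : 0 < N%:R :> R by rewrite ltr0n (leq_ltn_trans _ kN).
have -> : fiber N k [set z] = angle_set [set turn u0].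
  apply/seteqP; split=> [u [u01 fu]|u [u01 /= uu]].
    split=> //=; have : phi N (turn ((u + k%:R) / N%:R)) = phi N (turn ((u0 + k%:R) / N%:R)).
      by rewrite fu fu0.
    by rewrite !phi_turn ![N%:R * _]mulrC !divfK ?gt_eqF// !turnDn.
  split=> //; suff -> : u = u0 by [].
  by move/(@turn_inj _ 0): uu; rewrite add0r; exact.
by rewrite -premeas_mass s0.
Qed.

End Psi_premeasure.

(** * Push-forward of a transfer *)

Section periodic_sums.
Variable V : zmodType.
Implicit Types f : nat -> V.

Lemma periodicD_mul f n q j : (forall i, f (i + n)%N = f i) -> f (j + q * n)%N = f j.
Proof. by move=> fn; elim: q => [|q IH]; rewrite ?addn0// mulSnr addnA fn. Qed.

(** Injectivity mod n makes [h] permute the residues. It serves for the shifts j -> j + i and for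
    multiplication by an integer coprime to n. *)
Lemma sum_reindex_mod f n (h : nat -> nat) :
  (forall j, f (j + n)%N = f j) ->
  (forall i j, (i < n)%N -> (j < n)%N -> h i = h j %[mod n] -> i = j) ->
  \sum_(0 <= j < n) f (h j) = \sum_(0 <= j < n) f j.
Proof.
case: n => [|n] fn hinj; first by rewrite !big_geq.
have fmod j : f (j %% n.+1)%N = f j.
  by rewrite [in RHS](divn_eq j n.+1) addnC periodicD_mul.
pose p (i : 'I_n.+1) : 'I_n.+1 := Ordinal (ltn_pmod (h i) (ltn0Sn n)).
have pinj : injective p.
  by move=> i j /(congr1 val)/= e; apply: val_inj; exact: hinj e.
rewrite !big_mkord [RHS](reindex_inj pinj)/=.
by apply: eq_bigr => i _; rewrite fmod.
Qed.

Lemma sum_periodic_mul f n d : (forall j, f (j + n)%N = f j) ->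
  \sum_(0 <= j < n * d) f j = (\sum_(0 <= j < n) f j) *+ d.
Proof.
move=> fn; elim: d => [|d IH]; first by rewrite muln0 big_geq.
rewrite mulnS addnC (big_cat_nat (leq0n (n * d)%N))/= ?leq_addr// IH mulrSr; congr (_ + _).
rewrite -{1}[(n * d)%N]add0n big_addn addKn; apply: eq_bigr => j _.
by rewrite mulnC periodicD_mul.
Qed.

Lemma sum_nat_multiples f m n : (0 < m)%N ->
  (forall k, ~~ (m %| k)%N -> f k = 0) ->
  \sum_(0 <= k < n * m) f k = \sum_(0 <= k < n) f (k * m)%N.
Proof.
move=> m0 f0; elim: n => [|n IH]; first by rewrite mul0n !big_geq.
rewrite big_nat_recr//= -IH mulSnr (big_cat_nat (leq0n (n * m)%N))/= ?leq_addr//.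
congr (_ + _); rewrite big_ltn; last by rewrite -{1}[(n * m)%N]addn0 ltn_add2l.
rewrite big_nat big1 ?addr0// => k /andP[k1 k2]; apply: f0.
rewrite -(subnK (ltnW k1)) addnC dvdn_addr ?dvdn_mull//.
by apply/negP => /dvdn_leq; rewrite subn_gt0 => /(_ k1); lia.
Qed.

End periodic_sums.

Section commutation.
Variable R : realType.
Implicit Types (C : set (circle R)) (V J : set R).

(** The meeting point of the two sides of the commutation: these sets are the fibers of preimages
    under power maps ([fiber_phi]), and they split into branches over ordinary fibers of [C]
    ([twisted_fiber_branch]). *)
Definition twisted_fiber M N j C : set R :=
  [set u | 0 <= u < 1 /\ C (turn ((M%:R * u + j%:R) / N%:R))].

(* The part of the preimage of [V] under [u |-> M u mod 1] where
   [floor (M u) = i]. *)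
Definition branch M i V : set R :=
  [set u | 0 <= u < 1 /\ (0 <= M%:R * u - i%:R < 1 /\ V (M%:R * u - i%:R))].

Lemma is_interval_branch M i J : is_interval J -> is_interval (branch M i J).
Proof.
move=> iJ x y [/andP[x0 x1] [/andP[mx0 mx1] Jx]] [/andP[y0 y1] [/andP[my0 my1] Jy]] z.
move=> /andP[xz zy].
have hx : M%:R * x <= M%:R * z by rewrite ler_wpM2l.
have hy : M%:R * z <= M%:R * y by rewrite ler_wpM2l.
split; first by apply/andP; split; lra.
split; first by apply/andP; split; lra.
by apply: iJ Jx Jy _ _; apply/andP; split; lra.
Qed.

Lemma branch_trivIset M (V : nat -> set R) : trivIset setT (fun i => branch M i (V i)).
Proof.
move=> i j _ _ [u [[_ [/andP[i1 i2] _]] [_ [/andP[j1 j2] _]]]].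
have : (i%:R < j.+1%:R :> R) /\ (j%:R < i.+1%:R :> R).
  by rewrite -!natr1; split; lra.
by rewrite !ltr_nat !ltnS => -[? ?]; apply/eqP; rewrite eqn_leq; apply/andP.
Qed.

Lemma branch_ex M (u : R) : (0 < M)%N -> 0 <= u < 1 ->
  exists2 i : 'I_M, True & 0 <= M%:R * u - i%:R < 1.
Proof.
move=> M0 /andP[u0 u1]; have M0' : 0 < M%:R :> R by rewrite ltr0n.
have Mu0 : 0 <= M%:R * u by rewrite mulr_ge0// ltW.
have /andP[h1 h2] := truncn_itv Mu0.
have iM : (Num.truncn (M%:R * u) < M)%N.
  by rewrite -(ltr_nat R) (le_lt_trans h1)// gtr_pMr.
by exists (Ordinal iM) => //=; rewrite -natr1 in h2; apply/andP; split; lra.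
Qed.

Lemma angle_set_phi M C : (0 < M)%N ->
  angle_set (phi M @^-1` C) = \bigcup_(i in [set: 'I_M]) branch M i (angle_set C).
Proof.
move=> M0; apply/seteqP; split=> [u [u01 Cu]|u [i _ [u01 [_ [_]]]]].
  have [i _ hi] := branch_ex M0 u01; exists i => //; split=> //; split=> //.
  split=> //; rewrite -(turnDn _ i) subrK.
  by rewrite -phi_turn.
by rewrite -(turnDn _ i) subrK -phi_turn; split.
Qed.

Lemma decomposable_phi M C : (0 < M)%N -> Defs.arc C -> decomposable (phi M @^-1` C).
Proof.
move=> M0 /arc_angle_set[J1 [J2 [i1 i2 J12 CJ]]].
apply: (@decomposable_fin _ ('I_M * bool)%type
  (fun ib => branch M ib.1 (if ib.2 then J1 else J2))).
- by move=> [i [|]]; exact: is_interval_branch.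
- move=> [i b] [j c] _ _ [u [/= ui uj]].
  have ij : i = j.
    by apply/val_inj/(@branch_trivIset M (fun=> setT)) => //; exists u; split;
      [case: ui => ? []|case: uj => ? []].
  rewrite -{}ij in uj *; congr (_, _).
  move: ui uj J12 => [_ [_ ui]] [_ [_ uj]]; rewrite -subset0 => J12.
  by case: b c ui uj => [|] [|]// h1 h2; case: (J12 (M%:R * u - i%:R)).
- rewrite angle_set_phi// CJ; apply/seteqP; split=> [u [i _ [u01 [ui [|] uJ]]]|].
  + by exists (i, true).
  + by exists (i, false).
  + move=> u [[i [|]] _ [u01 [ui uJ]]]; exists i => //; split=> //; split=> //.
      by left.
    by right.
Qed.

Lemma twisted_fiberDn M N j C : (0 < N)%N ->
  twisted_fiber M N (j + N) C = twisted_fiber M N j C.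
Proof.
move=> N0; have N0' : N%:R != 0 :> R by rewrite pnatr_eq0 -lt0n.
rewrite /twisted_fiber; apply/seteqP.
by split=> u; rewrite /= natrD addrA [(_ + N%:R) / _]mulrDl divff// turnD1.
Qed.

Lemma twisted_fiber1 N j C : twisted_fiber 1 N j C = fiber N j C.
Proof. by apply/seteqP; split=> u; rewrite /twisted_fiber/fiber/= mul1r. Qed.

Lemma fiberDn N j C : (0 < N)%N -> fiber N (j + N) C = fiber N j C.
Proof. by rewrite -!twisted_fiber1; exact: twisted_fiberDn. Qed.

(** The common factor d cancels: M d (u + k) / (N d) = (M u + M k) / N. *)
Lemma fiber_phi M N d k C : (0 < d)%N ->
  fiber (N * d) k (phi (M * d) @^-1` C) = twisted_fiber M N (M * k) C.
Proof.
move=> d0; have d0' : d%:R != 0 :> R by rewrite pnatr_eq0 -lt0n.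
apply/seteqP; rewrite /fiber/twisted_fiber.
have E (u : R) : (M * d)%:R * ((u + k%:R) / (N * d)%:R) =
    (M%:R * u + (M * k)%:R) / N%:R.
  by rewrite !natrM invfM -mulrDr [LHS]mulrACA -!mulrA [d%:R * _]mulrC -!mulrA
     mulVf// mulr1; ring.
by split=> u /= [u01]; rewrite phi_turn E.
Qed.

(** Where floor(M u) = i, one has M u + j = (M u - i) + (j + i) with M u - i in [0, 1[, so the fiber
    index shifts by i. *)
Lemma twisted_fiber_branch M N j C : (0 < M)%N ->
  twisted_fiber M N j C = \bigcup_(i in [set: 'I_M]) branch M i (fiber N (j + i) C).
Proof.
move=> M0.
have E (u : R) i : M%:R * u - i%:R + (j + i)%:R = M%:R * u + j%:R.
  by rewrite natrD; ring.
apply/seteqP; split=> [u [u01 Cu]|u [i _ [u01 [_ [_]]]]].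
  have [i _ hi] := branch_ex M0 u01; exists i => //; split=> //; split=> //.
  by split=> //; rewrite E.
by rewrite E; split.
Qed.

Lemma branchU M i V1 V2 : branch M i (V1 `|` V2) = branch M i V1 `|` branch M i V2.
Proof.
apply/seteqP; split=> [u [u01 [ui [|] uJ]]|u [[u01 [ui uJ]]|[u01 [ui uJ]]]].
- by left.
- by right.
- by split=> //; split=> //; left.
- by split=> //; split=> //; right.
Qed.

Lemma measurable_branch M i J : is_interval J -> measurable (branch M i J).
Proof. by move=> iJ; apply: is_interval_measurable; exact: is_interval_branch. Qed.

Lemma measurable_branch_fiber M N i j C : (0 < N)%N -> Defs.arc C ->
  measurable (branch M i (fiber N j C)).
Proof.
move=> N0 aC.
(* The shifted index may exceed N, whereas the description by intervals needs an index below N. *)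
have -> : fiber N j C = fiber N (j %% N) C.
  rewrite {1}(divn_eq j N) addnC; elim: (j %/ N)%N => [|q IH].
    by rewrite mul0n addn0.
  by rewrite mulSnr addnA fiberDn.
have [J1 [J2 [i1 i2 _ ->]]] := fiber_intervals (ltn_pmod j N0) aC.
by rewrite branchU; apply: measurableU; exact: measurable_branch.
Qed.

Variables (mu : set (circle R) -> R) (g : set R -> R).
Hypotheses (ag : finitely_additive g)
  (mug : forall C, Defs.arc C -> mu C = g (angle_set C)).

Lemma push_branch M J : (0 < M)%N -> is_interval J -> J `<=` unit_turn ->
  push M mu (turn @` J) = \sum_(i < M) g (branch M i J).
Proof.
move=> M0 iJ J01; have aJ := arc_turn iJ.
rewrite /push (ext_additive ag mug); last exact: decomposable_phi.
rewrite angle_set_phi// angle_set_turn//.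
rewrite -(@finitely_additive_bigcup _ g 'I_M (fun i => branch M i J) predT)//.
- by congr (g (bigcup _ _)); apply/seteqP; split.
- by move=> i; exact: measurable_branch.
- by move=> i j _ _ h; apply: val_inj; exact: (@branch_trivIset M (fun=> J)).
Qed.

(** The push-forward is only known to vanish on arcs, and a fiber need not give one; its two
    intervals do, each separately. *)
Lemma sum_branch_fiber_eq0 M N k C : (0 < M)%N -> (k < N)%N -> Defs.arc C ->
  (forall D, Defs.arc D -> push M mu D = 0) ->
  \sum_(i < M) g (branch M i (fiber N k C)) = 0.
Proof.
move=> M0 kN aC push0; have [J1 [J2 [i1 i2 J12 fJ]]] := fiber_intervals kN aC.
have fJ01 : J1 `|` J2 `<=` unit_turn by rewrite -fJ; exact: fiber01.
have J1_01 : J1 `<=` unit_turn by move=> u Ju; apply: fJ01; left.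
have J2_01 : J2 `<=` unit_turn by move=> u Ju; apply: fJ01; right.
rewrite fJ; under eq_bigr => i _.
  rewrite branchU (ag.2 _ _ (measurable_branch M i i1) (measurable_branch M i i2)).
    over.
  move: J12; rewrite -!subset0 => J12 u [[_ [_ u1]] [_ [_ u2]]].
  by case: (J12 (M%:R * u - i%:R)).
rewrite big_split/= -!push_branch// !push0 ?addr0//; exact: arc_turn.
Qed.

(** For each fixed branch i the shift j -> j + i permutes the residues mod N; after this change of
    index, the sum over i is a push-forward of an unshifted fiber. *)
Lemma sum_twisted_fiber_eq0 M N C : (0 < M)%N -> Defs.arc C ->
  (forall D, Defs.arc D -> push M mu D = 0) ->
  \sum_(0 <= j < N) g (twisted_fiber M N j C) = 0.
Proof.
move=> M0 aC push0; case: (posnP N) => [->|N0]; first by rewrite big_geq.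
transitivity (\sum_(0 <= j < N) \sum_(i < M) g (branch M i (fiber N (j + i) C))).
  apply: eq_bigr => j _; rewrite twisted_fiber_branch//.
  rewrite -(@finitely_additive_bigcup _ g 'I_M
    (fun i => branch M i (fiber N (j + i) C)) predT)//.
  - by congr (g (bigcup _ _)); apply/seteqP; split.
  - by move=> i; exact: measurable_branch_fiber.
  - move=> i1 i2 _ _ h; apply: val_inj.
    exact: (@branch_trivIset M (fun i => fiber N (j + i) C)).
rewrite exchange_big/=.
under eq_bigr => i _.
  rewrite (@sum_reindex_mod _ (fun j => g (branch M i (fiber N j C))) N (fun j => j + i)%N).
  - over.
  - by move=> j; rewrite fiberDn.
  - by move=> j1 j2 h1 h2 /eqP; rewrite eqn_modDr !modn_small// => /eqP.
rewrite exchange_big/= big_nat big1// => j /andP[_ jN].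
exact: sum_branch_fiber_eq0.
Qed.

(** Only M k mod N matters: the N d sectors run d times through the residues, which cancels the d in
    1/(N d), and k -> M k permutes them because M and N are coprime. *)
Lemma transfer_phi M N d C : (0 < d)%N -> (0 < N)%N -> coprime M N ->
  transfer g (N * d) (phi (M * d) @^-1` C) =
  N%:R^-1 * \sum_(0 <= j < N) g (twisted_fiber M N j C).
Proof.
move=> d0 N0 cMN; rewrite /transfer.
under eq_bigr do rewrite fiber_phi//.
rewrite (@sum_periodic_mul _ (fun k => g (twisted_fiber M N (M * k) C))); last first.
  move=> k; rewrite mulnDr.
  by apply: (@periodicD_mul _ (fun j => g (twisted_fiber M N j C))) => j;
    rewrite twisted_fiberDn.
rewrite (@sum_reindex_mod _ (fun j => g (twisted_fiber M N j C)) N (fun j => M * j)%N).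
- rewrite -[_ *+ d]mulr_natr natrM invfM mulrACA mulVf ?mulr1//.
  by rewrite pnatr_eq0 -lt0n.
- by move=> j; rewrite twisted_fiberDn.
- have inj i j : (i <= j)%N -> (j < N)%N -> M * i = M * j %[mod N] -> i = j.
    move=> ij jN /eqP; rewrite eq_sym eqn_mod_dvd ?leq_mul2l ?ij ?orbT//.
    rewrite -mulnBr Gauss_dvdr 1?coprime_sym// => Nij.
    apply/eqP; rewrite eqn_leq ij/= -subn_eq0.
    by apply: contraTT Nij => ji; rewrite gtnNdvd ?lt0n// (leq_ltn_trans (leq_subr _ _)).
  move=> i j iN jN e; case: (leqP i j) => [ij|/ltnW ji]; first exact: inj.
  by apply/esym/inj.
Qed.

End commutation.

(** * Coprime parts in the monoid *)

Section monoid.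
Variables (s : nat) (N : 'I_s -> nat).
Hypothesis N_ge2 : forall i, (2 <= N i)%N.
Hypothesis N_coprime : forall i j, i != j -> coprime (N i) (N j).

Lemma coprime_prod_exp (a b : 'I_s -> nat) : (forall i, a i = 0%N \/ b i = 0%N) ->
  coprime (\prod_i N i ^ a i) (\prod_i N i ^ b i).
Proof.
move=> ab; rewrite /coprime; apply: (big_ind (fun m => coprime m _)).
- exact: coprime1n.
- by move=> x y hx hy; rewrite coprimeMl hx.
- move=> i _; apply: (big_ind (fun m => coprime _ m)).
  + exact: coprimen1.
  + by move=> x y hx hy; rewrite coprimeMr hx.
  + move=> j _; have [<-|ij] := eqVneq i j; last first.
      by apply: coprimeXl; apply: coprimeXr; exact: N_coprime.
    by case: (ab i) => ->; rewrite expn0 ?coprime1n ?coprimen1.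
Qed.

(** Take d from the minima of the exponents and m', n' from their truncated differences: at each
    generator one of the two differences is 0, and distinct generators are coprime. This also keeps
    m' and n' in the monoid. *)
Lemma generated_monoid_coprime_parts m n :
  generated_monoid N m -> generated_monoid N n ->
  exists m' n' d, [/\ generated_monoid N m', generated_monoid N n', (0 < d)%N,
    coprime m' n' & m = (m' * d)%N /\ n = (n' * d)%N].
Proof.
move=> [a _ <-] [b _ <-].
exists (\prod_i N i ^ (a i - b i))%N, (\prod_i N i ^ (b i - a i))%N.
exists (\prod_i N i ^ minn (a i) (b i))%N; split.
- by exists (fun i => a i - b i)%N.
- by exists (fun i => b i - a i)%N.
- by apply: (generated_monoid_gt0 N_ge2); exists (fun i => minn (a i) (b i)).
- by apply: coprime_prod_exp => i; lia.
- rewrite -!big_split/=; split; apply: eq_bigr => i _; rewrite -expnD; congr (_ ^ _)%N; lia.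
Qed.

Lemma generated_monoidM m n : generated_monoid N m -> generated_monoid N n ->
  generated_monoid N (m * n)%N.
Proof.
move=> [a _ <-] [b _ <-]; exists (fun i => a i + b i)%N => //.
by rewrite -big_split/=; apply: eq_bigr => i _; rewrite expnD.
Qed.

End monoid.

(** * Invariance of [Psi] *)

Section invariance.
Variable R : realType.
Variables (s : nat) (N : 'I_s -> nat).
Hypothesis N_ge2 : forall i, (2 <= N i)%N.
Hypothesis N_coprime : forall i j, i != j -> coprime (N i) (N j).

Let S := generated_monoid N.

Lemma Psi_invariant (sigma : borel_charge R) (B : R) :
  (forall n, \sum_(0 <= m < n | m \in S) m%:R^-1 <= B) ->
  Z S (@M0 R) sigma -> invariant_premeasure S (Psi S sigma).
Proof.
move=> hB [s0 Zs] M SM C aC.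
have M0 : (0 < M)%N by exact: generated_monoid_gt0 SM.
have mA := mass_additive sigma.
have mE D : Defs.arc D -> premeas sigma D = mass sigma (angle_set D).
  by move=> _; exact: premeas_mass.
have dA := decomposable_phi M0 aC.
have [n [D AD]] := dA; have [aD _ _] := AD.
rewrite /push (ext_Psi s0 hB)// (PsiE _ _ aC).
(* The terms of the series for M_* Psi, padded by 0 outside [S]: only the indices m M with m in [S]
   survive, and there the term is that of Psi at m. *)
pose F m := if m \in S then transfer (mass sigma) m (phi M @^-1` C) else 0.
have F_mul m : m \in S -> F (m * M)%N = transfer (mass sigma) m C.
  rewrite inE => Sm; have m0 : (0 < m)%N by exact: generated_monoid_gt0 Sm.
  rewrite /F mem_set; last exact: generated_monoidM.
  rewrite -[M in phi M]mul1n transfer_phi ?coprime1n// /transfer.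
  by under eq_bigr do rewrite twisted_fiber1.
have F0 m : (forall m', m' \in S -> m != (m' * M)%N) -> F m = 0.
  move=> hm; rewrite /F; case: ifP => //; rewrite inE => Sm.
  have [M' [m' [d [SM' Sm' d0 cop [ME mE']]]]] :=
    generated_monoid_coprime_parts N_ge2 N_coprime SM Sm.
  have m'0 : (0 < m')%N by exact: generated_monoid_gt0 Sm'.
  rewrite [in phi M]ME mE' transfer_phi//.
  rewrite (@sum_twisted_fiber_eq0 _ (premeas sigma)) ?mulr0//.
    exact: generated_monoid_gt0 SM'.
  (* The hypothesis on [sigma] applies to M' since M' = 1 would make m the multiple m' M, which is
     excluded. *)
  move=> E aE; apply: Zs => // M'1; have := hm m'; rewrite mem_set// => /(_ isT).
  by rewrite ME M'1 mul1n mE' eqxx.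
have cv : cvgn (fun n => \sum_(0 <= m < n | m \in S) transfer (mass sigma) m (phi M @^-1` C)).
  rewrite (_ : (fun n => _) = (fun m => \sum_(j < n) \sum_(0 <= k < m | k \in S)
      transfer (mass sigma) k (D j))).
    apply/cvg_ex; eexists; apply: cvg_sum_seq => j _; exact: (sum_transfer_cvg s0 hB).
  apply/funext => m; rewrite exchange_big/=; apply: eq_bigr => k _.
  exact: transfer_decomposition.
(* The partial sums of Psi up to n equal those of the pushed series up to n M, so a subsequence of a
   convergent sequence is compared. *)
have mulM : (n * M)%N @[n --> \oo] --> \oo.
  by move=> A [K _ KA]; exists K => // k /= Kk; apply: KA => /=; nia.
apply/esym/cvg_lim => //.
rewrite (_ : (fun n => _) = (fun n => \sum_(0 <= m < n * M | m \in S)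
    transfer (mass sigma) m (phi M @^-1` C))).
  exact: (@cvg_comp _ _ _ (fun n => n * M)%N (fun n => \sum_(0 <= m < n | m \in S)
    transfer (mass sigma) m (phi M @^-1` C)) _ _ _ mulM cv).
apply/funext => k; rewrite [LHS]big_mkcond [RHS]big_mkcond/=.
rewrite [RHS](@sum_nat_multiples _ F)//.
  apply: eq_bigr => m _; case: ifPn => [mS|mS]; first by rewrite F_mul.
  rewrite F0// => m' m'S; rewrite eqn_pmul2r//.
  by apply: contraNneq mS => ->.
move=> m; apply: contraNeq => Fm.
have [[m' m'S /eqP ->]|no] := pselect (exists2 m', m' \in S & m == (m' * M)%N).
  exact: dvdn_mull.
case/eqP: Fm; apply: F0 => m' m'S; apply/negP => e; apply: no; exists m' => //.
Qed.

End invariance.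

Theorem corollary50 (R : realType) (s : nat) (N : 'I_s -> nat)
    (s_ge1 : (1 <= s)%N) (N_ge2 : forall i, (2 <= N i)%N)
    (N_coprime : forall i j, i != j -> coprime (N i) (N j)) :
  let S := generated_monoid N in
  [/\ forall sigma : borel_charge R, M0 sigma -> P_kappa s (Psi S sigma),
      Psi S @` Z S (@M0 R) `<=`
        [set mu | P_kappa s mu /\ invariant_premeasure S mu]
    & Psi S @` Z S (@M0c R) `<=`
        [set mu | [/\ P_kappa s mu, atomless mu & invariant_premeasure S mu]]].
Proof.
move=> S.
have S0 m : m \in S -> (0 < m)%N by rewrite inE; exact: generated_monoid_gt0.
have [A A0 hA] := @sum_min_le_kappa R s N N_ge2.
(* The case x = 1 of the monoid estimate, since 1/m <= 1 for m in [S]. *)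
have hB n : \sum_(0 <= m < n | m \in S) (m%:R^-1 : R) <= A * kappa s 1.
  apply: le_trans (hA n 1 _); last by rewrite ler01 lexx.
  apply: ler_sum => m mS; rewrite le_min lexx andbT.
  by rewrite invf_le1 ?ler1n ?ltr0n S0.
have Pk (sigma : borel_charge R) : M0 sigma -> P_kappa s (Psi S sigma).
  by move=> s0; exact: (Psi_P_kappa s0 hB A0 hA S0).
have inv (sigma : borel_charge R) : Z S (@M0 R) sigma -> invariant_premeasure S (Psi S sigma).
  exact: Psi_invariant hB.
split=> //.
- by move=> _ [sigma [s0 Zs] <-]; split; [exact: Pk|exact: inv].
- move=> _ [sigma [[s0 ats] Zs] <-]; split; [exact: Pk| |exact: inv].
  exact: Psi_atomless.
Qed.
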